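(* Let $\mathbf{k}$ be an algebraically closed field, let $V$ be a $\mathbf{k}$-vector space of dimension $n\geq 3$, and let $K\subseteq\bigwedge^2V$ be a linear subspace. If $\operatorname{char}(\mathbf{k})=0$ or $\operatorname{char}(\mathbf{k})\geq n-2$, then $$\mathcal{R}(V,K)=\{0\}\iff W_q(V,K)=0\ \text{ for all } q\geq n-3.$$
   Context: Let $S=\operatorname{Sym}V$. The Koszul module $W(V,K)$ is the middle homology of the complex $K\otimes S\xrightarrow{\ \delta_2|_{K\otimes S}\ }V\otimes S\xrightarrow{\ \delta_1\ }S$, where $\delta_1,\delta_2$ are the Koszul differentials, $\delta_1(v\otimes f)=vf$ and $\delta_2((v\wedge w)\otimes f)=v\otimes wf-w\otimes vf$ (up to sign). It is graded with $K$ placed in degree $0$, so $$W_q(V,K)=\frac{\ker\bigl(V\otimes\operatorname{Sym}^{q+1}V\to\operatorname{Sym}^{q+2}V\bigr)}{\delta_2\bigl(K\otimes\operatorname{Sym}^qV\bigr)}\qquad(q\geq 0).$$ Let $K^{\perp}\subseteq\bigwedge^2V^{\vee}$ be the kernel of the restriction map $\bigwedge^2V^\vee\to K^\vee$. The resonance variety is $$\mathcal{R}(V,K)=\{a\in V^\vee:\ \text{there exists } b\in V^\vee\text{ with } a\wedge b\in K^\perp\setminus\{0\}\}\cup\{0\}.$$ *)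

(* Defs.v *)
From HB Require Import structures.
From mathcomp Require Import all_boot all_algebra.
From mathcomp.multinomials Require Import mpoly.

Set Implicit Arguments.
Unset Strict Implicit.
Unset Printing Implicit Defensive.

Import GRing.Theory.

Local Open Scope ring_scope.
Local Open Scope quotient_scope.

(* Tensor products, exterior squares and symmetric powers are built on the basis
   e_i of each vector space chosen by [vbasis].  The universal properties
   [tens_liftE], [tens_gen], [ext2_liftE] and [ext2_gen] determine the first two
   independently of that choice. *)
Definition bas (k : fieldType) (U : vectType k) (i : 'I_(\dim {:U})) : U :=
  (vbasis {:U})`_i.

Definition crd (k : fieldType) (U : vectType k) (i : 'I_(\dim {:U})) (u : U) : k :=
  coord (vbasis {:U}) i u.

Section Basis.
Variables (k : fieldType) (U : vectType k).

Lemma crdP i (a : k) (u v : U) : crd i (a *: u + v) = a * crd i u + crd i v.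
Proof. by rewrite /crd linearP. Qed.

Lemma crd_bas i j : crd i (bas j : U) = (i == j)%:R.
Proof. by rewrite /crd /bas coord_free ?(basis_free (vbasisP _)) // eq_sym. Qed.

Lemma sum_crd (u : U) : \sum_i crd i u *: bas i = u.
Proof. exact/esym/(coord_vbasis (memvf u)). Qed.

End Basis.

(* U (x) W, where f stands for \sum_i e_i (x) f i *)
Definition tensor (k : fieldType) (U W : vectType k) : Type :=
  {ffun 'I_(\dim {:U}) -> W}.

HB.instance Definition _ (k : fieldType) (U W : vectType k) :=
  Vector.on (tensor U W).

Definition tens (k : fieldType) (U W : vectType k) (u : U) (w : W) : tensor U W :=
  [ffun i => crd i u *: w].

(* the linear map on U (x) W induced by a bilinear B *)
Definition tens_lift (k : fieldType) (U W X : vectType k) (B : U -> W -> X)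
    (t : tensor U W) : X :=
  \sum_i B (bas i) (t i).

(* the exterior square of U, with basis e_i /\ e_j for i < j *)
Definition ext2 (k : fieldType) (U : vectType k) : Type :=
  {ffun {p : 'I_(\dim {:U}) * 'I_(\dim {:U}) | (p.1 < p.2)%N} -> k^o}.

HB.instance Definition _ (k : fieldType) (U : vectType k) := Vector.on (ext2 U).

Definition wedge (k : fieldType) (U : vectType k) (u v : U) : ext2 U :=
  [ffun p => crd (val p).1 u * crd (val p).2 v - crd (val p).2 u * crd (val p).1 v].

(* the linear map on the exterior square induced by an alternating bilinear B *)
Definition ext2_lift (k : fieldType) (U X : vectType k) (B : U -> U -> X)
    (w : ext2 U) : X :=
  \sum_p w p *: B (bas (val p).1) (bas (val p).2).

Definition bilin (k : fieldType) (U W X : vectType k) (B : U -> W -> X) : Prop :=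
  (forall w, linear (B^~ w)) /\ (forall u, linear (B u)).

Definition alternating (k : fieldType) (U X : vectType k) (B : U -> U -> X) : Prop :=
  forall u, B u u = 0.

Section Bilinear.
Variables (k : fieldType) (U W X : vectType k).

Lemma linear_sum_bas (f : U -> X) : linear f ->
  forall u, f u = \sum_i crd i u *: f (bas i).
Proof.
move=> lf u; pose fM := GRing.isLinear.Build k U X _ f lf.
pose f' : {linear U -> X} := HB.pack f fM.
rewrite -[f]/(f' : U -> X) -{1}(sum_crd u) linear_sum.
by apply: eq_bigr => i _; rewrite linearZ.
Qed.

Lemma tens_bilin : bilin (@tens k U W).
Proof.
split=> [w a u v | u a v w]; apply/ffunP=> i; rewrite !ffunE.
  by rewrite crdP scalerDl scalerA.
by rewrite scalerDr !scalerA mulrC.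
Qed.

Lemma tens_lift_linear (B : U -> W -> X) : (forall u, linear (B u)) ->
  linear (tens_lift B).
Proof.
move=> lB a s t; rewrite /tens_lift scaler_sumr -big_split /=.
by apply: eq_bigr => i _; rewrite !ffunE lB.
Qed.

Lemma tens_liftE (B : U -> W -> X) : bilin B ->
  forall u w, tens_lift B (tens u w) = B u w.
Proof.
case=> lB1 lB2 u w; rewrite (linear_sum_bas (lB1 w)); apply: eq_bigr => i _.
pose fM := GRing.isLinear.Build k W X _ _ (lB2 (bas i)).
pose f : {linear W -> X} := HB.pack (B (bas i)) fM.
by rewrite ffunE -[B _]/(f : W -> X) linearZ.
Qed.

Lemma tens_gen (t : tensor U W) : t = \sum_i tens (bas i) (t i).
Proof.
apply/ffunP=> j; rewrite sum_ffunE (bigD1 j) //= ffunE crd_bas eqxx scale1r.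
rewrite big1 ?addr0 // => i ij; rewrite ffunE crd_bas eq_sym (negPf ij).
exact: scale0r.
Qed.

Lemma wedge_bilin : bilin (@wedge k U).
Proof.
split=> [w a u v | u a v w]; apply/ffunP=> p; rewrite !ffunE !crdP.
  by rewrite !mulrDl opprD addrACA -!mulrA -mulrBr.
rewrite !mulrDr opprD addrACA; congr (_ + _).
by rewrite ![_ * (a * _)]mulrCA -mulrBr.
Qed.

Lemma wedge_alt : alternating (@wedge k U).
Proof. by move=> u; apply/ffunP=> p; rewrite !ffunE mulrC subrr. Qed.

Lemma ext2_lift_linear (B : U -> U -> X) : linear (ext2_lift B).
Proof.
move=> a s t; rewrite /ext2_lift scaler_sumr -big_split /=.
by apply: eq_bigr => p _; rewrite !ffunE scalerDl scalerA.
Qed.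

End Bilinear.

Section Ext2Universal.
Variables (k : fieldType) (U X : vectType k).

Lemma ext2_liftE (B : U -> U -> X) : bilin B -> alternating B ->
  forall u v, ext2_lift B (wedge u v) = B u v.
Proof.
move=> [lB1 lB2] aB u v.
have B0 a b : B b a = - B a b.
  have DB1 x y z : B (x + y) z = B x z + B y z.
    by have := lB1 z 1 x y; rewrite !scale1r.
  have DB2 x y z : B z (x + y) = B z x + B z y.
    by have := lB2 z 1 x y; rewrite !scale1r.
  apply/eqP; rewrite -addr_eq0; have := aB (a + b).
  by rewrite DB1 !DB2 !aB add0r addr0 addrC => ->.
pose F (p : 'I_(\dim {:U}) * 'I_(\dim {:U})) :=
  (crd p.1 u * crd p.2 v) *: B (bas p.1) (bas p.2).
have -> : B u v = \sum_p F p.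
  rewrite (linear_sum_bas (lB1 v)).
  under eq_bigr do rewrite (linear_sum_bas (lB2 _)) scaler_sumr.
  rewrite pair_bigA /=; apply: eq_bigr => p _.
  by rewrite scalerA.
pose P := [pred p : 'I_(\dim {:U}) * 'I_(\dim {:U}) | (p.1 < p.2)%N].
pose Q := [pred p : 'I_(\dim {:U}) * 'I_(\dim {:U}) | (p.2 < p.1)%N].
have -> : \sum_p F p = \sum_(p in P) F p + \sum_(p in Q) F p.
  rewrite (bigID (mem P)) /=; congr (_ + _).
  rewrite (bigID (mem Q)) /= [X in _ + X]big1 ?addr0 => [|p].
    by apply: eq_bigl => p; rewrite !inE /= -leqNgt andb_idl // => /ltnW.
  rewrite !inE -!leqNgt -eqn_leq => /eqP e.
  by rewrite /F -(val_inj e) aB scaler0.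
have -> : \sum_(p in Q) F p = \sum_(p in P) F (p.2, p.1).
  rewrite (reindex_inj (h := fun p => (p.2, p.1))) => [|[? ?] [? ?] [-> ->] //].
  by apply: eq_bigl => p; rewrite !inE.
rewrite -big_split /= (big_sub P) /ext2_lift.
apply: eq_bigr => p _; rewrite ffunE /F /=.
by rewrite (B0 (bas (val p).1)) scalerN -scalerBl.
Qed.

Lemma ext2_gen (w : ext2 U) :
  w = \sum_p w p *: wedge (bas (val p).1) (bas (val p).2).
Proof.
apply/ffunP=> p; rewrite sum_ffunE (bigD1 p) //= big1 => [|q neq].
  rewrite addr0 !ffunE !crd_bas !eqxx /= -!val_eqE /=.
  by rewrite (ltn_eqF (valP p)) mulr0 mulr1 subr0 [RHS]mulr1.
rewrite !ffunE !crd_bas -!val_eqE /=.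
case: q neq => -[q1 q2] /= ltq; case: p => -[p1 p2] /= ltp neq.
have -> : (p1 == q1 :> nat)%:R * (p2 == q2 :> nat)%:R = 0 :> k.
  case: (altP (p1 =P q1 :> nat)) => [e1|]; last by rewrite mul0r.
  case: (altP (p2 =P q2 :> nat)) => [e2|]; last by rewrite mulr0.
  case/negP: neq; apply/eqP/val_inj => /=.
  by rewrite (val_inj e1) (val_inj e2).
have -> : (p2 == q1 :> nat)%:R * (p1 == q2 :> nat)%:R = 0 :> k.
  case: (altP (p2 =P q1 :> nat)) => [e1|]; last by rewrite mul0r.
  case: (altP (p1 =P q2 :> nat)) => [e2|]; last by rewrite mulr0.
  by have := ltp; rewrite e1 e2 ltnNge ltnW.
by rewrite subr0 [LHS]mulr0.
Qed.

End Ext2Universal.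

(* Sym^q V: homogeneous polynomials of degree q in the basis vectors of V *)
Definition sym (k : fieldType) (V : vectType k) (q : nat) : Type :=
  dhomog (\dim {:V}) k q.

HB.instance Definition _ (k : fieldType) (V : vectType k) q :=
  GRing.Lmodule.on (sym V q).

Definition dhomog_dim (n d : nat) : nat :=
  if n is m.+1 then 'C(d + m, d) else (d == 0)%N.

Lemma dhomog_vect_iso (k : fieldType) (n d : nat) :
  vector_axiom (dhomog_dim n d) (dhomog n k d).
Proof.
case: n => [|n]; last exact: dhomog_vecaxiom.
exists (fun p : dhomog 0 k d => \row_(i < (d == 0)%N) (p : {mpoly k[0]})@_0%MM).
  by move=> a p q; apply/rowP=> i; rewrite !mxE /= mcoeffD mcoeffZ.
have m0 (m : 'X_{1..0}) : m = 0%MM by apply/mnmP => -[].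
case: d => [|d].
  have hg (r : 'rV[k]_1) : ((r 0 0)%:MP : {mpoly k[0]}) \is 0.-homog.
    by rewrite -[_%:MP]mulr1 mul_mpolyC rpredZ // dhomog1.
  exists (fun r => DHomog (hg r)) => [p | r].
    by apply/val_inj/mpolyP => m /=; rewrite mcoeffC !mxE (m0 m) eqxx mulr1.
  by apply/rowP=> i; rewrite mxE /= mcoeffC eqxx mulr1 !ord1.
exists (fun=> 0) => [p | r]; last by apply/rowP=> -[].
apply/val_inj/mpolyP => m /=; rewrite mcoeff0 (m0 m); apply/esym.
by apply: (dhomog_nemf_coeff (dhomog_is_dhomog p)); rewrite mf0.
Qed.

HB.instance Definition _ (k : fieldType) (V : vectType k) q :=
  Lmodule_hasFinDim.Build k (sym V q) (@dhomog_vect_iso k (\dim {:V}) q).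

(* the canonical inclusion of V in Sym V *)
Definition sym1 (k : fieldType) (V : vectType k) (v : V) : {mpoly k[\dim {:V}]} :=
  \sum_i crd i v *: 'X_i.

Lemma sym1_homog (k : fieldType) (V : vectType k) (v : V) :
  sym1 v \is 1.-homog.
Proof.
apply: rpred_sum => i _; apply: rpredZ; rewrite dhomogX; exact/eqP/mdeg1.
Qed.

Definition vmul (k : fieldType) (V : vectType k) (q : nat) (v : V) (f : sym V q) :
    sym V q.+1 :=
  DHomog (dhomogM (sym1_homog v) (dhomog_is_dhomog f)).

Section VmulBilinear.
Variables (k : fieldType) (V : vectType k) (q : nat).

Lemma sym1_linear : linear (@sym1 k V).
Proof.
move=> a u v; rewrite /sym1 scaler_sumr -big_split /=.
by apply: eq_bigr => i _; rewrite crdP scalerDl scalerA.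
Qed.

Lemma vmul_bilin : bilin (@vmul k V q).
Proof.
split=> [f a u v | u a f g]; apply: val_inj => /=.
  by rewrite sym1_linear mulrDl -scalerAl.
by rewrite mulrDr -scalerAr.
Qed.

Lemma vmulC (u v : V) (f : sym V q) : vmul u (vmul v f) = vmul v (vmul u f).
Proof. by apply: val_inj; rewrite /= mulrCA. Qed.

End VmulBilinear.

Lemma linfunE (k : fieldType) (U X : vectType k) (f : U -> X) :
  linear f -> linfun f =1 f.
Proof.
move=> lf; pose fM := GRing.isLinear.Build k U X _ f lf.
exact: (lfunE (HB.pack f fM : {linear U -> X})).
Qed.

Lemma tens_linfunE (k : fieldType) (U W X : vectType k) (B : U -> W -> X) :
  bilin B -> linfun (tens_lift B) =1 tens_lift B.
Proof. by case=> _ lB; apply/linfunE/tens_lift_linear. Qed.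

Lemma ext2_linfunE (k : fieldType) (U X : vectType k) (B : U -> U -> X) :
  linfun (ext2_lift B) =1 ext2_lift B.
Proof. exact/linfunE/ext2_lift_linear. Qed.

Section Koszul.
Variables (k : fieldType) (V : vectType k).

Definition delta1 (q : nat) : 'Hom(tensor V (sym V q), sym V q.+1) :=
  linfun (tens_lift (@vmul k V q)).

Definition koszul2 (q : nat) (f : sym V q) (u v : V) : tensor V (sym V q.+1) :=
  tens u (vmul v f) - tens v (vmul u f).

Definition delta2 (q : nat) :
    'Hom(tensor (ext2 V) (sym V q), tensor V (sym V q.+1)) :=
  linfun (tens_lift (fun w f => ext2_lift (koszul2 f) w)).

(* K (x) Sym^q V as a subspace of (ext2 V) (x) Sym^q V *)
Definition ktens (K : {vspace ext2 V}) (q : nat) :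
    {vspace tensor (ext2 V) (sym V q)} :=
  limg (linfun (tens_lift (fun (w : subvs_of K) (f : sym V q) => tens (val w) f))).

Lemma delta1E q v (f : sym V q) : delta1 q (tens v f) = vmul v f.
Proof.
by rewrite /delta1 (tens_linfunE (@vmul_bilin k V q)) (tens_liftE (@vmul_bilin k V q)).
Qed.

Lemma koszul2_bilin q (f : sym V q) : bilin (koszul2 f).
Proof.
have [[lt1 lt2] [lv1 lv2]] := (tens_bilin V (sym V q.+1), @vmul_bilin k V q).
by split=> [w a u v | w a u v]; rewrite /koszul2 lt1 lv1 lt2;
  rewrite scalerBr opprD addrACA.
Qed.

Lemma koszul2_alt q (f : sym V q) : alternating (koszul2 f).
Proof. by move=> u; rewrite /koszul2 subrr. Qed.

Lemma koszul2_linear q u v : linear (fun f : sym V q => koszul2 f u v).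
Proof.
have [[lt1 lt2] [lv1 lv2]] := (tens_bilin V (sym V q.+1), @vmul_bilin k V q).
by move=> a f g; rewrite /koszul2 !lv2 !lt2 scalerBr opprD addrACA.
Qed.

Lemma delta2_bilin q :
  bilin (fun (w : ext2 V) (f : sym V q) => ext2_lift (koszul2 f) w).
Proof.
split=> [f | w a f g]; first exact: ext2_lift_linear.
rewrite /ext2_lift scaler_sumr -big_split /=; apply: eq_bigr => p _.
by rewrite koszul2_linear scalerDr !scalerA mulrC.
Qed.

Lemma delta2E q u v (f : sym V q) :
  delta2 q (tens (wedge u v) f) = tens u (vmul v f) - tens v (vmul u f).
Proof.
rewrite /delta2 (tens_linfunE (delta2_bilin q)) (tens_liftE (delta2_bilin q)).
by rewrite (ext2_liftE (koszul2_bilin f) (koszul2_alt f)).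
Qed.

Lemma delta1_delta2 q t : delta1 q.+1 (delta2 q t) = 0.
Proof.
rewrite (tens_gen t) !linear_sum big1 //= => i _.
rewrite /delta2 (tens_linfunE (delta2_bilin q)) (tens_liftE (delta2_bilin q)).
rewrite linear_sum big1 //= => p _.
by rewrite linearZ linearB /= !delta1E vmulC subrr scaler0.
Qed.

Lemma ktens_bilin (K : {vspace ext2 V}) q :
  bilin (fun (w : subvs_of K) (f : sym V q) => tens (val w) f).
Proof.
have [lt1 lt2] := tens_bilin (ext2 V) (sym V q).
by split=> [f a w w' | w a f g]; rewrite ?lt2 // linearP lt1.
Qed.

Lemma ktens_mem (K : {vspace ext2 V}) q w (f : sym V q) :
  w \in K -> tens w f \in ktens K q.
Proof.
move=> wK.
have := memv_img (linfun (tens_lift (fun (w : subvs_of K) (f : sym V q) =>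
  tens (val w) f))) (memvf (tens (Subvs wK) f)).
by rewrite (tens_linfunE (ktens_bilin K q)) (tens_liftE (ktens_bilin K q)).
Qed.

End Koszul.

(* Z / (Z :&: B), the quotient Z / B when B is a subspace of Z *)
Definition quotv (k : fieldType) (X : vectType k) (Z B : {vspace X}) : zmodType :=
  Quotient.quot (pred_of_vspace (linfun (@vsval k X Z) @^-1: B)%VS).

Lemma quotv_eq0 (k : fieldType) (X : vectType k) (Z B : {vspace X}) :
  (forall x : quotv Z B, x = 0) <-> (Z <= B)%VS.
Proof.
pose I := (linfun (@vsval k X Z) @^-1: B)%VS.
pose Q := Quotient.quot (pred_of_vspace I).
have piE (z : subvs_of Z) : (\pi_Q z == 0 :> Q) = (val z \in B).
  rewrite -[0 in LHS](raddf0 \pi_Q) -Quotient.idealrBE subr0.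
  by rewrite -memv_preim lfunE.
split=> [all0 | /subvP ZB x].
  by apply/subvP=> z zZ; rewrite -[z]/(val (Subvs zZ)) -piE; apply/eqP/all0.
rewrite -[x](@reprK _ Q); apply/eqP.
by rewrite [_ == _]piE ZB // subvsP.
Qed.

(* [delta1_delta2] puts the second argument of [quotv] inside the first. *)
Definition koszul_module (k : fieldType) (V : vectType k) (K : {vspace ext2 V})
    (q : nat) : zmodType :=
  quotv (lker (delta1 V q.+1)) (delta2 V q @: ktens K q)%VS.

Lemma koszul_module_eq0 (k : fieldType) (V : vectType k) (K : {vspace ext2 V}) q :
  (forall x : koszul_module K q, x = 0) <->
  lker (delta1 V q.+1) = (delta2 V q @: ktens K q)%VS.
Proof.
rewrite quotv_eq0; split=> [sub | -> //]; apply/eqP; rewrite eqEsubv sub /=.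
apply/subvP=> _ /memv_imgP[t _ ->].
by rewrite memv_ker delta1_delta2.
Qed.

Section Resonance.
Variables (k : fieldType) (V : vectType k).

(* a /\ b as the functional u /\ v |-> a u * b v - a v * b u *)
Definition wedge_fun (a b : 'Hom(V, k^o)) : 'Hom(ext2 V, k^o) :=
  linfun (ext2_lift (fun u v => a u * b v - a v * b u : k^o)).

(* the canonical map from the exterior square of the dual to the dual of the
   exterior square *)
Definition ext2_dual (phi : ext2 'Hom(V, k^o)) : 'Hom(ext2 V, k^o) :=
  ext2_lift wedge_fun phi.

Definition restr (K : {vspace ext2 V}) :
    'Hom(ext2 'Hom(V, k^o), 'Hom(subvs_of K, k^o)) :=
  linfun (fun phi => ext2_dual phi \o linfun (@vsval k (ext2 V) K))%VF.

Definition perp (K : {vspace ext2 V}) : {vspace ext2 'Hom(V, k^o)} :=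
  lker (restr K).

Definition resonance (K : {vspace ext2 V}) (a : 'Hom(V, k^o)) : Prop :=
  (exists b : 'Hom(V, k^o), wedge a b \in perp K /\ wedge a b <> 0) \/ a = 0.

Lemma wedge_funE a b u v : wedge_fun a b (wedge u v) = a u * b v - a v * b u.
Proof.
rewrite /wedge_fun ext2_linfunE.
rewrite ext2_liftE // => [|x]; last exact: subrr.
have sE c x : c *: (x : k^o) = c * x :> k by [].
split=> [w c x y | w c x y]; rewrite !linearP /= !sE.
  rewrite mulrDl mulrDr opprD addrACA mulrN.
  by rewrite (mulrCA (a w)) (mulrCA (a x)) -(mulrA c).
by rewrite mulrDl mulrDr opprD addrACA mulrN -(mulrA c).
Qed.

Lemma wedge_fun_bilin : bilin wedge_fun.
Proof.
have sE c x : c *: (x : k^o) = c * x :> k by [].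
split=> [b c a a' | a c b b']; apply/lfunP=> w;
  rewrite !lfunE /= lfunE /= !ext2_linfunE /ext2_lift scaler_sumr -big_split /=;
  apply: eq_bigr => p _; rewrite !lfunE /= !lfunE /= !sE;
  rewrite (mulrCA c) -mulrDr; congr (_ * _); rewrite mulrBr.
  by rewrite !mulrDl opprD addrACA !mulrA.
by rewrite !mulrDr opprD addrACA !(mulrCA c).
Qed.

Lemma wedge_fun_alt : alternating wedge_fun.
Proof.
move=> a; apply/lfunP=> w; rewrite ext2_linfunE zero_lfunE /ext2_lift.
by rewrite big1 // => p _; rewrite [X in _ *: (_ - X)]mulrC subrr scaler0.
Qed.

Lemma ext2_dualE a b u v :
  ext2_dual (wedge a b) (wedge u v) = a u * b v - a v * b u.
Proof.
rewrite /ext2_dual (ext2_liftE wedge_fun_bilin wedge_fun_alt).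
exact: wedge_funE.
Qed.

Lemma perpP (K : {vspace ext2 V}) phi :
  reflect {in K, forall w, ext2_dual phi w = 0} (phi \in perp K).
Proof.
have lr : linear (fun phi => ext2_dual phi \o linfun (@vsval k (ext2 V) K))%VF.
  move=> c f g; rewrite /ext2_dual ext2_lift_linear.
  by rewrite comp_lfunDl comp_lfunZl.
rewrite memv_ker /restr (linfunE lr); apply: (iffP eqP) => [r0 w wK | p0].
  by have /lfunP/(_ (Subvs wK)) := r0; rewrite comp_lfunE lfunE /= zero_lfunE.
apply/lfunP=> w; rewrite comp_lfunE lfunE zero_lfunE /=.
by rewrite p0 // subvsP.
Qed.

End Resonance.

(* Main.v *)
(* Write S = Sym V and let w act on a point a of V^dual by contraction, giving
   the map K (x) S -> ker (delta_1 : V (x) S -> S(1)), whose fibre at a sends w to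
   w(a, -) in the annihilator of a.  All these fibres with a <> 0 are onto if and
   only if the resonance is trivial.

   If a /\ b is a nonzero element of K^perp, then z |-> \sum_i b_i z_i(a) is a
   functional on V (x) S which kills delta_2 (K (x) S) but not delta_2 (/\^2 V (x) S),
   so no W_q vanishes.

   If the resonance is trivial, resolve the divided powers of V^dual / a in the
   Buchsbaum-Rim complex of the map above by the multiplication with a on the
   divided powers of V^dual.  This is possible in degrees j <= n - 3 because these
   j are invertible in k.  One gets a complex of free graded S-modules
     S(2) <- V (x) S(1) <- K (x) S <- C_3 <- ... <- C_(n+1)
   with C_i generated in degree n + i - 5 for i >= 3, with homology W at V (x) S(1),
   and exact away from the origin at C_1, ..., C_n, hence with homology of finite
   length there by the Nullstellensatz.  If x is a variable and H_(i+1)(C / x)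
   vanishes in degrees > e, then x is injective on H_i(C) in degrees >= e, so
   H_i(C) vanishes there.  Cutting by the n variables reduces the vanishing of W_q
   for q >= n - 3 to the fact that C_(n+1) (x) k lives in degree 2n - 4. *)
From HB Require Import structures.
Require Import Defs.
From mathcomp Require Import all_boot all_algebra.
From mathcomp Require Import ring.
From mathcomp.classical Require boolp classical_sets.
From mathcomp.multinomials Require Import mpoly.

Set Implicit Arguments.
Unset Strict Implicit.
Unset Printing Implicit Defensive.

Import GRing.Theory.

Local Open Scope ring_scope.

(** * Homogeneous components of polynomials *)

Section Homogeneous.
Variables (R : fieldType) (n : nat).
Implicit Types (p q f : {mpoly R[n]}).

Lemma pihomogMl e d q p : q \is e.-homog ->
  pihomog mdeg (e + d) (q * p) = q * pihomog mdeg d p.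
Proof.
move=> hq; elim/mpolyind: p => [|c m p _ _ IH].
  by rewrite mulr0 !pihomog0 mulr0.
rewrite mulrDr !pihomogD mulrDr IH -scalerAr !linearZ /= -scalerAr.
congr (_ *: _ + _).
have hm : q * 'X_[m] \is (e + mdeg m).-homog by apply: dhomogM hq _; rewrite dhomogX.
rewrite pihomogX; case: eqP => [<-|neq]; first by rewrite pihomog_dE.
rewrite mulr0 (pihomog_ne0 _ hm) // eqn_add2l; exact/eqP.
Qed.

Lemma pihomogMl_lt e d q p : q \is e.-homog -> (d < e)%N ->
  pihomog mdeg d (q * p) = 0.
Proof.
move=> hq lt; elim/mpolyind: p => [|c m p _ _ IH].
  by rewrite mulr0 pihomog0.
rewrite mulrDr pihomogD IH addr0 -scalerAr linearZ /=.
have hm : q * 'X_[m] \is (e + mdeg m).-homog by apply: dhomogM hq _; rewrite dhomogX.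
by rewrite (pihomog_ne0 _ hm) ?scaler0 // gtn_eqF // ltn_addr.
Qed.

(** The monomials of degree d, padded with zeros. The size is a successor because [horner_mx] needs
    square matrices of positive size. *)
Lemma homog_spanning d : exists (D : nat) (e : 'I_D.+1 -> {mpoly R[n]}),
  [/\ forall b, e b \is d.-homog,
      forall b, e b = 0 \/ exists2 m, mdeg m = d & e b = 'X_[m] &
      forall f, f \is d.-homog -> exists c : 'rV[R]_D.+1, f = \sum_b c 0 b *: e b].
Proof.
pose T : finType := [the finType of 'X_{1..n < d.+1}].
pose F (m : T) : {mpoly R[n]} := if mdeg m == d then 'X_[m] else 0.
have FP m : F m = 0 \/ exists2 m', mdeg m' = d & F m = 'X_[m'].
  by rewrite /F; case: eqP => [dm|_]; [right; exists m | left].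
pose lookup A (x : A) (G : T -> A) (b : 'I_#|T|.+1) : A :=
  oapp (G \o enum_val) x (insub (val b) : option 'I_#|T|).
have lookupE A (x : A) G (b : 'I_#|T|) : lookup A x G (widen_ord (leqnSn _) b) = G (enum_val b).
  by rewrite /lookup /= valK.
pose e := lookup _ 0 F.
have eP b : e b = 0 \/ exists2 m, mdeg m = d & e b = 'X_[m].
  by rewrite /e /lookup; case: insub => [m|] /=; [apply: FP | left].
exists #|T|, e; split=> // [b|f hf].
  by case: (eP b) => [->|[m dm ->]]; rewrite ?dhomog0 // dhomogX; apply/eqP.
exists (\row_b lookup _ 0 (fun m : T => f@_(val m)) b).
under eq_bigr do rewrite mxE.
rewrite big_ord_recr /= {2}/lookup insubF ?ltnn //= scale0r addr0.
transitivity (\sum_(m : T) f@_(val m) *: F m).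
  transitivity (\sum_(m : T | mdeg m == d) f@_m *: 'X_[R, m]); last first.
    by rewrite big_mkcond /=; apply: eq_bigr => m _; rewrite /F; case: eqP => //; rewrite scaler0.
  rewrite -[LHS](pihomog_dE hf); apply: pihomogwE.
  by rewrite msizeE; apply/bigmax_leqP_seq => m mf _; rewrite (dhomogP _ _ _ hf).
rewrite (reindex _ (onW_bij _ (@enum_val_bij T))); apply: eq_bigr => b _.
by rewrite /e !lookupE.
Qed.
End Homogeneous.

(** * The homogeneous Nullstellensatz *)

Section Nullstellensatz.
Variables (k : closedFieldType) (n : nat).
Local Notation S := {mpoly k[n]}.
Implicit Types (M N : S -> Prop) (f g h : S).

(** The empty predicate qualifies: it is the union of the empty chain, to which Zorn's lemma is
    applied as well. *)
Definition homog_ideal M :=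
  [/\ forall f g, M f -> M g -> M (f + g), forall h f, M f -> M (h * f) &
      forall d f, M f -> M (pihomog mdeg d f)].

(** For a homogeneous ideal M, this says that S / M has infinite length. *)
Definition misses_every_degree M :=
  forall q, exists2 m : 'X_{1..n}, mdeg m = q & ~ M 'X_[m].

Definition maximal_missing M :=
  [/\ homog_ideal M, misses_every_degree M &
      forall N, homog_ideal N -> (forall f, M f -> N f) ->
        misses_every_degree N -> forall f, N f -> M f].

Section Maximal.
Variables (M : S -> Prop) (maxM : maximal_missing M) (M0 : M 0).

Let MD f g : M f -> M g -> M (f + g). Proof. by case: maxM => -[D _ _] _ _; apply: D. Qed.
Let MM h f : M f -> M (h * f). Proof. by case: maxM => -[_ m _] _ _; apply: m. Qed.
Let MZ c f : M f -> M (c *: f). Proof. by rewrite -mul_mpolyC; apply: MM. Qed.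
Let Msum I (r : seq I) (P : pred I) (F : I -> S) :
  (forall i, P i -> M (F i)) -> M (\sum_(i <- r | P i) F i).
Proof. by move=> h; apply: big_ind => // f g; apply: MD. Qed.

(** Maximality is applied to the homogeneous ideal M + (f): being strictly larger than M, it
    contains all monomials of some degree. *)
Lemma maximal_absorbs d f : f \is d.-homog -> ~ M f ->
  exists q, forall m, mdeg m = q -> exists h, M ('X_[m] - h * f).
Proof.
move=> hf nMf; apply: boolp.contrapT => nex; apply: nMf.
have [[D Mu P] _ mx] := maxM.
apply: (mx (fun g => exists h, M (g - h * f))) => [|g Mg|q|].
- split=> [g g' [h Mg] [h' Mg'] | h' g [h Mg] | d' g [h Mg]].
  + by exists (h + h'); rewrite mulrDl opprD addrACA; apply: MD.
  + by exists (h' * h); rewrite -mulrA -mulrBr; apply: MM.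
  have := P d' _ Mg; rewrite pihomogB mulrC.
  have [le|lt] := leqP d d'; last by rewrite (pihomogMl_lt _ hf lt) => Mg'; exists 0; rewrite mul0r.
  by rewrite -(subnKC le) (pihomogMl _ _ hf) => Mg'; exists (pihomog mdeg (d' - d) h); rewrite mulrC.
- by exists 0; rewrite mul0r subr0.
- apply: boolp.contrapT => nm; apply: nex; exists q => m dm; apply: boolp.contrapT => nh.
  by apply: nm; exists m.
by exists 1; rewrite mul1r subrr.
Qed.

(** If M + (f) contains S_q and M + (g) contains S_q', then M + (f g) contains S_(q + q'). *)
Lemma maximal_prime d e f g : f \is d.-homog -> g \is e.-homog -> ~ M f -> ~ M g ->
  ~ M (f * g).
Proof.
move=> hf hg /(maximal_absorbs hf)[q Hq] /(maximal_absorbs hg)[q' Hq'] Mfg.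
have [_ /(_ (q + q')%N) [m dm nM] _] := maxM; apply: nM.
have [m1 [m2 [-> d1 d2]]] : exists m1 m2 : 'X_{1..n}, [/\ m = (m1 + m2)%MM, mdeg m1 = q & mdeg m2 = q'].
  elim: q' q m dm {Hq Hq'} => [|q' IH] q m dm.
    by exists m, 0%MM; rewrite addm0 mdeg0 -{1}(addn0 q).
  have [i mi] : exists i, (0 < m i)%N.
    apply: boolp.contrapT => no; move: dm; rewrite mdegE big1 ?addnS // => i _.
    by apply/eqP; rewrite -leqn0 leqNgt; apply/negP => mi; apply: no; exists i.
  have Um : (U_(i) <= m)%MM by apply/mnm_lepP => j; rewrite mnm1E; case: eqP => // <-.
  have [|m1 [m2 [e1 d1 d2]]] := IH q (m - U_(i))%MM.
    by apply/eqP; rewrite -(eqn_add2r 1) -{1}(mdeg1 i) -mdegD submK // dm addnS addn1.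
  exists m1, (m2 + U_(i))%MM; rewrite mdegD mdeg1 d2 addn1 addmA -e1 submK //.
rewrite mpolyXD; have [h1 M1] := Hq _ d1; have [h2 M2] := Hq' _ d2.
have -> : 'X_[m1] * 'X_[m2] = 'X_[m2] * ('X_[m1] - h1 * f) + (h1 * f) * ('X_[m2] - h2 * g)
   + h1 * h2 * (f * g) :> S.
  by ring.
by apply: MD; [apply: MD|]; apply: MM.
Qed.


Lemma dhomog_var i : ('X_i : S) \is 1.-homog.
Proof. by rewrite dhomogX; apply/eqP/mdeg1. Qed.

(* The ratio of two variables acts on the finite dimensional space S_q / M for
   large q, hence is a root of its characteristic polynomial; M being prime, the
   ratio is one of the eigenvalues. *)
Lemma maximal_ratio i l : ~ M 'X_i -> exists z : k, M ('X_l - z *: 'X_i).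
Proof.
move=> nMi; have [q Hq] := maximal_absorbs (dhomog_var i) nMi.
set x : S := 'X_i; set y : S := 'X_l.
have [D [e [he eX span]]] := homog_spanning k n q.
pose comb (v : 'rV[k]_D.+1) := \sum_b v 0 b *: e b.
have comb_lin a u v : comb (a *: u + v) = a *: comb u + comb v.
  rewrite /comb scaler_sumr -big_split; apply: eq_bigr => b _ /=.
  by rewrite !mxE scalerDl scalerA.
have hc v : comb v \is q.-homog by apply: rpred_sum => b _; apply: rpredZ.
(* As ['X_[m]] is congruent to h x modulo M, the degree q part of y h represents the quotient of y
   ['X_[m]] by x. *)
have /fin_all_exists[t Ht] b : exists c, M (y * e b - x * comb c).
  have [->|[m dm ->]] := eX b.
    exists 0; rewrite mulr0 /comb big1 ?mulr0 ?subrr // => c _.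
    by rewrite mxE scale0r.
  have [h Mh] := Hq _ dm.
  have [c hcE] := span _ (pihomogP mdeg q (y * h)).
  exists c; rewrite -[comb c]hcE; case: maxM => -[_ _ P] _ _.
  have := P (1 + q)%N _ (MM y Mh).
  have -> : y * ('X_[m] - h * 'X_i) = y * 'X_[m] - x * (y * h) by rewrite /x; ring.
  rewrite pihomogB (pihomogMl _ _ (dhomog_var i)) pihomog_dE //.
  by apply: dhomogM (dhomog_var l) _; rewrite dhomogX; apply/eqP.
pose T := \matrix_(b, c) t b 0 c.
have step z v : M ((y - z *: x) * comb v - x * comb (v *m (T - z%:M))).
  have -> : comb (v *m (T - z%:M)) = \sum_b v 0 b *: comb (t b) - z *: comb v.
    have -> : v *m (T - z%:M) = - z *: v + v *m T.
      by rewrite mulmxBr mul_mx_scalar scaleNr addrC.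
    rewrite comb_lin scaleNr addrC; congr (_ - _).
    rewrite /comb; under [RHS]eq_bigr do rewrite scaler_sumr.
    rewrite exchange_big; apply: eq_bigr => c _ /=.
    by rewrite mxE scaler_suml; apply: eq_bigr => b _; rewrite mxE scalerA.
  have -> : (y - z *: x) * comb v - x * (\sum_b v 0 b *: comb (t b) - z *: comb v)
     = \sum_b v 0 b *: (y * e b - x * comb (t b)).
    transitivity (y * comb v - x * \sum_b v 0 b *: comb (t b)).
      by rewrite -!mul_mpolyC; ring.
    rewrite {1}/comb !mulr_sumr -sumrB; apply: eq_bigr => b _.
    by rewrite scalerBr !scalerAr.
  by apply: Msum => b _; apply: MZ.
(* Iterating [step]: modulo M, the product of the y - z x acts on S_q as a power of x times the
   product of the T - z. *)
have steps r v : M (\prod_(z <- r) (y - z *: x) * comb v -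
    x ^+ size r * comb (v *m horner_mx T (\prod_(z <- r) ('X - z%:P)))).
  elim: r v => [|z r IH] v.
    by rewrite !big_nil rmorph1 mulmx1 subrr.
  rewrite !big_cons rmorphM /= rmorphB /= horner_mx_X horner_mx_C mulmxA exprS.
  set P := \prod_(_ <- _) _; set H := horner_mx _ _; set v' := v *m _.
  have -> : (y - z *: x) * P * comb v - x * x ^+ size r * comb (v' *m H) =
    P * ((y - z *: x) * comb v - x * comb v') +
    x * (P * comb v' - x ^+ size r * comb (v' *m H)).
    rewrite -mul_mpolyC; ring.
  by apply: MD; apply: MM; [apply: step | apply: IH].
have [r Dr] := closed_field_poly_normal (char_poly T).
have CH := Cayley_Hamilton T; rewrite Dr (monicP (char_poly_monic T)) scale1r in CH.
have [b nMb] : exists b, ~ M (e b).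
  have [_ /(_ q) [m dm nM] _] := maxM; apply: boolp.contrapT => nb; apply: nM.
  have [|c ->] := span 'X_[m]; first by rewrite dhomogX; apply/eqP.
  apply: Msum => b _; apply: MZ; apply: boolp.contrapT => nMb; apply: nb.
  by exists b.
(* For r the list of eigenvalues, Cayley-Hamilton puts the product of the y - z x and the form
   [e b], itself outside M, into M. *)
have := steps r (delta_mx 0 b); rewrite CH mulmx0.
have comb0 : comb 0 = 0 by rewrite /comb big1 // => c _; rewrite mxE scale0r.
have -> : comb (delta_mx 0 b) = e b.
  rewrite /comb (bigD1 b) //= mxE !eqxx scale1r big1 ?addr0 // => c cb.
  by rewrite mxE (negPf cb) andbF scale0r.
rewrite comb0 mulr0 subr0 => Mprod; apply: boolp.contrapT => nz.
have hyx z : y - z *: x \is 1.-homog by apply: rpredB; rewrite ?rpredZ ?dhomog_var.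
suff: ~ M (\prod_(z <- r) (y - z *: x) * e b) by [].
elim: {Dr CH Mprod} r => [|z r IH]; first by rewrite big_nil mul1r.
have [d hd] : exists d, \prod_(z <- r) (y - z *: x) * e b \is d.-homog.
  exists (size r + q)%N; apply: dhomogM (he b); elim: {IH} r => [|a r IH].
    by rewrite big_nil dhomog1.
  by rewrite big_cons; apply: dhomogM (hyx a) IH.
rewrite big_cons -mulrA; apply: (maximal_prime (hyx z) hd) => // Mz.
by apply: nz; exists z.
Qed.

(** M contains the ideal of the projective point whose coordinates are the ratios of
    [maximal_ratio], normalized at a variable outside M. *)
Lemma maximal_point : exists (a : 'I_n -> k) (i : 'I_n),
  [/\ a i = 1, ~ M 'X_i &
      forall d f, f \is d.-homog -> M (f - f.@[a] *: 'X_i ^+ d)].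
Proof.
have [_ /(_ 1%N) [m /eqP/mdeg1P[i /eqP->] nMi] _] := maxM.
have /fin_all_exists[b Hb] l := maximal_ratio l nMi.
pose a l := if l == i then 1 else b l.
have Ha l : M ('X_l - a l *: 'X_i).
  by rewrite /a; case: eqP => [->|_] //; rewrite scale1r subrr.
exists a, i; split=> // [|d f hf]; first by rewrite /a eqxx.
have HX m' : M ('X_[m'] - ('X_[m'] : S).@[a] *: 'X_i ^+ mdeg m').
  rewrite mevalX mpolyXE_id mdegE.
  elim/big_rec3: _ => [|l e' p c _ IH]; first by rewrite scale1r subrr.
  have -> : 'X_l ^+ m' l * p - (a l ^+ m' l * e') *: 'X_i ^+ (m' l + c) =
    'X_l ^+ m' l * (p - e' *: 'X_i ^+ c) +
    e' *: 'X_i ^+ c * ('X_l ^+ m' l - (a l *: 'X_i) ^+ m' l) :> S.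
    rewrite exprZn exprD -!mul_mpolyC mpolyCM; ring.
  apply: MD; apply: MM => //.
  by rewrite subrXX mulrC; apply: MM.
have -> : f - f.@[a] *: 'X_i ^+ d =
  \sum_(m' <- msupp f) f@_m' *: ('X_[m'] - ('X_[m'] : S).@[a] *: 'X_i ^+ d).
  under eq_bigr do rewrite scalerBr.
  rewrite sumrB -mpolyE mevalE scaler_suml; congr (_ - _).
  by apply: eq_bigr => m' _; rewrite mevalX scalerA.
rewrite big_seq; apply: Msum => m' fm'; apply: MZ.
by rewrite -(dhomogP _ _ _ hf _ fm').
Qed.

End Maximal.

(** Otherwise the homogeneous part of J lies in an ideal M that is maximal among those missing every
    degree. A form of J not vanishing at the point of M puts a power of a variable outside M into M,
    against primality. *)
Theorem homog_nullstellensatz (J : S -> Prop) :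
    J 0 -> (forall f g, J f -> J g -> J (f + g)) -> (forall h f, J f -> J (h * f)) ->
    (forall a : 'I_n -> k, (exists i, a i != 0) ->
       exists d f, [/\ f \is d.-homog, J f & f.@[a] != 0]) ->
  exists s, forall m, mdeg m = s -> J 'X_[m].
Proof.
move=> J0 JD JM pts; apply: boolp.contrapT => nJ.
(* The largest homogeneous ideal inside J, which is itself not assumed homogeneous. *)
pose H f := forall d, J (pihomog mdeg d f).
have H0 : H 0 by move=> d; rewrite pihomog0.
have Hhom d f : f \is d.-homog -> J f -> H f.
  move=> hf Jf e; have [<-|ne] := eqVneq d e; first by rewrite pihomog_dE.
  by rewrite (pihomog_ne0 ne hf).
have HD f g : H f -> H g -> H (f + g).
  by move=> Hf Hg d; rewrite pihomogD; apply: JD.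
have idealH : homog_ideal H.
  split=> // [h f Hf d | d f Hf]; last exact: Hhom (pihomogP mdeg d f) (Hf d).
  elim/mpolyind: h => [|c m h _ _ IH]; first by rewrite mul0r pihomog0.
  rewrite mulrDl pihomogD; apply: JD => //.
  rewrite -scalerAl linearZ /= -mul_mpolyC; apply: (JM).
  have hm : ('X_[m] : S) \is (mdeg m).-homog by rewrite dhomogX.
  have [le|lt] := leqP (mdeg m) d; last by rewrite (pihomogMl_lt _ hm lt).
  by rewrite -(subnKC le) (pihomogMl _ _ hm); apply: JM.
have missH : misses_every_degree H.
  move=> q; apply: boolp.contrapT => nq; apply: nJ; exists q => m dm.
  apply: boolp.contrapT => nJm; apply: nq; exists m => // /(_ q).
  by rewrite pihomogX /= dm eqxx.
(* The last clause replaces the inclusion of [H] in M, which fails for the empty predicate. *)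
pose P (M : S -> Prop) := [/\ homog_ideal M, misses_every_degree M &
  forall f g, M f -> H g -> M (f + g)].
have PH : P H by [].
have [|M [PM maxM]] := @classical_sets.Zorn_bigcup S P.
  move=> F FP tot.
  have dir (X Y : S -> Prop) f g : F X -> F Y -> X f -> Y g ->
      exists Z : S -> Prop, [/\ F Z, Z f & Z g].
    by move=> FX FY Xf Yg; case: (tot X Y FX FY) => sub; [exists Y | exists X]; split=> //; apply: sub.
  split; first split.
  - move=> f g [X FX Xf] [Y FY Yg]; have [Z [FZ Zf Zg]] := dir _ _ _ _ FX FY Xf Yg.
    by exists Z => //; have [[D _ _] _ _] := FP _ FZ; apply: D.
  - by move=> h f [X FX Xf]; exists X => //; have [[_ Mu _] _ _] := FP _ FX; apply: Mu.
  - by move=> d f [X FX Xf]; exists X => //; have [[_ _ p] _ _] := FP _ FX; apply: p.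
  - move=> q; apply: boolp.contrapT => nq.
    have [[X0 FX0]|noF] := boolp.pselect (exists X, F X); last first.
      have [m dm _] := missH q; apply: nq; exists m => // -[X FX _].
      by apply: noF; exists X.
    (* There are finitely many monomials of degree q, so if the union of the chain contained them
       all, one member would. *)
    have cover (r : seq 'X_{1..n}) : (forall m, m \in r -> mdeg m = q) ->
        exists2 X : S -> Prop, F X & forall m, m \in r -> X 'X_[m].
      elim: r => [|m r IH] rq; first by exists X0.
      have [|X FX Xr] := IH; first by move=> m' m'r; apply: rq; rewrite inE m'r orbT.
      have [Y FY Ym] : (exists2 Y : S -> Prop, F Y & Y 'X_[m]).
        apply: boolp.contrapT => nY; apply: nq; exists m; first by apply: rq; rewrite mem_head.
        by case=> Y FY Ym; apply: nY; exists Y.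
      case: (tot X Y FX FY) => sub; [exists Y | exists X] => // m'; rewrite inE => /orP[/eqP->|/Xr] //.
        by move=> Xm'; apply: sub.
      exact: sub.
    pose r := [seq m <- [seq val m | m : 'X_{1..n < q.+1}] | mdeg m == q].
    have [|X FX Xr] := cover r; first by move=> m; rewrite mem_filter => /andP[/eqP].
    have [_ /(_ q)[m dm nXm] _] := FP _ FX; apply/nXm/Xr.
    rewrite mem_filter dm eqxx /=; apply/imageP.
    have lt : (mdeg m < q.+1)%N by rewrite dm.
    by exists (BMultinom lt).
  - by move=> f g [X FX Xf] Hg; exists X => //; have [_ _ ext] := FP _ FX; apply: ext.
have [idM missM extM] := PM.
(* A maximal M is nonempty, since [H] lies above the empty predicate. *)
have [f Mf] : exists f, M f.
  apply: boolp.contrapT => noM; apply: (maxM H) => //; split=> [f Mf|sub].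
    by case: noM; exists f.
  by apply: noM; exists 0; apply: sub.
have M0 : M 0 by have [_ Mu _] := idM; rewrite -(mul0r f); apply: Mu.
have mxM : maximal_missing M.
  split=> // N idN sub missN f' Nf'; apply: boolp.contrapT => nMf'.
  apply: (maxM N); first by split=> // sub'; apply/nMf'/sub'.
  split=> // g h Ng Hh; have [D _ _] := idN; apply: D => //.
  by apply: sub; rewrite -[h]add0r; apply: extM.
have [a [i [ai nMi Ma]]] := maximal_point mxM M0.
have [|d [g [hg Jg ga]]] := pts a; first by exists i; rewrite ai oner_neq0.
have [MD MM _] := idM.
have Mg : M g by rewrite -[g]add0r; apply: extM => //; apply: Hhom hg Jg.
have Mxd : M ('X_i ^+ d).
  have -> : 'X_i ^+ d = (g.@[a])^-1%:MP * (g + -1 * (g - g.@[a] *: 'X_i ^+ d)).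
    rewrite mulN1r opprB addrC subrK mul_mpolyC scalerA mulVf // scale1r //.
  by apply/MM/MD => //; apply/MM/Ma.
elim: d {hg Jg ga g Mg Ma pts} Mxd => [|d IH] Mxd.
  by apply: nMi; rewrite -[X in M X]mulr1; apply: MM.
have [Md|nMd] := boolp.lem (M ('X_i ^+ d)); first exact: IH.
have hd : ('X_i ^+ d : S) \is d.-homog by have := dhomogMn d (dhomog_var i); rewrite mul1n.
by have := maximal_prime mxM M0 (dhomog_var i) hd nMi nMd; rewrite -exprS.
Qed.

End Nullstellensatz.

(** * Exterior algebra and contractions *)

(* The exterior algebra of a free module of rank N, as
   E(N+1) = E(N) + e_0 /\ E(N). *)
Section ExteriorAlgebra.
Variable S : idomainType.

Fixpoint ext_alg (N : nat) : lmodType S :=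
  if N is N'.+1 then (ext_alg N' * ext_alg N')%type else S^o.

Definition shift (f : nat -> S) : nat -> S := fun j => f j.+1.

(** With (u1, u2) read as u1 + e_0 /\ u2, this is the antiderivation sending e_j to [f j]. *)
Fixpoint contract N (f : nat -> S) : ext_alg N -> ext_alg N :=
  match N with
  | 0 => fun _ => 0
  | N'.+1 => fun u => (f 0 *: u.2 + contract (shift f) u.1, - contract (shift f) u.2)
  end.

Fixpoint wedge_with N (w : nat -> S) : ext_alg N -> ext_alg N :=
  match N with
  | 0 => fun _ => 0
  | N'.+1 => fun u => (wedge_with (shift w) u.1, w 0 *: u.1 - wedge_with (shift w) u.2)
  end.

Fixpoint coef_map N (g : S -> S) : ext_alg N -> ext_alg N :=
  match N with
  | 0 => g
  | N'.+1 => fun u => (coef_map g u.1, coef_map g u.2)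
  end.

(** The scalar c in exterior degree 0; [coef0] and [coef1] read off the components in exterior
    degrees 0 and 1. *)
Fixpoint vacuum N (c : S) : ext_alg N :=
  match N with 0 => c | N'.+1 => (vacuum N' c, 0) end.

Fixpoint coef0 N : ext_alg N -> S :=
  match N with 0 => id | N'.+1 => fun u => coef0 u.1 end.

Fixpoint coef1 N (u : ext_alg N) (j : nat) : S :=
  match N return ext_alg N -> S with
  | 0 => fun _ => 0
  | N'.+1 => fun u => if j is j'.+1 then coef1 u.1 j' else coef0 u.2
  end u.

Definition dotp N (f w : nat -> S) : S := \sum_(j < N) f j * w j.

Lemma dotpS N f w : dotp N.+1 f w = f 0 * w 0 + dotp N (shift f) (shift w).
Proof. by rewrite /dotp big_ord_recl. Qed.

Lemma ext_pairD N (u v u' v' : ext_alg N) :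
  ((u, v) : ext_alg N.+1) + (u', v') = (u + u', v + v'). Proof. by []. Qed.
Lemma ext_pairZ N c (u v : ext_alg N) :
  c *: ((u, v) : ext_alg N.+1) = (c *: u, c *: v). Proof. by []. Qed.
Lemma ext_pairN N (u v : ext_alg N) :
  - ((u, v) : ext_alg N.+1) = (- u, - v). Proof. by []. Qed.
Lemma ext_pair0 N : (0 : ext_alg N.+1) = (0, 0). Proof. by []. Qed.

Lemma contract_is_linear N f : linear (@contract N f).
Proof.
elim: N f => [|N IH] f a u v; first by rewrite /= scaler0 addr0.
case: u v => [u u'] [v v']; rewrite ext_pairZ ext_pairD /= ext_pairZ ext_pairD.
congr (_, _); rewrite !IH; last by rewrite opprD scalerN.
by rewrite !scalerDr !scalerA mulrC addrACA.
Qed.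

HB.instance Definition _ N f :=
  GRing.isLinear.Build S (ext_alg N) (ext_alg N) _ (@contract N f) (contract_is_linear f).

Lemma contractZ N f c (u : ext_alg N) : contract f (c *: u) = c *: contract f u.
Proof. exact: linearZ. Qed.

Lemma contractN N f (u : ext_alg N) : contract f (- u) = - contract f u.
Proof. exact: raddfN. Qed.

Lemma contractD N f (u v : ext_alg N) : contract f (u + v) = contract f u + contract f v.
Proof. exact: raddfD. Qed.

Lemma wedge_with_is_linear N f : linear (@wedge_with N f).
Proof.
elim: N f => [|N IH] f a u v; first by rewrite /= scaler0 addr0.
case: u v => [u u'] [v v']; rewrite ext_pairZ ext_pairD /= ext_pairZ ext_pairD.
congr (_, _); rewrite !IH // opprD scalerBr scalerDr !scalerA mulrC.
by rewrite addrACA.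
Qed.

HB.instance Definition _ N f :=
  GRing.isLinear.Build S (ext_alg N) (ext_alg N) _ (@wedge_with N f) (wedge_with_is_linear f).

Lemma wedge_withZ N f c (u : ext_alg N) : wedge_with f (c *: u) = c *: wedge_with f u.
Proof. exact: linearZ. Qed.

Lemma wedge_withN N f (u : ext_alg N) : wedge_with f (- u) = - wedge_with f u.
Proof. exact: raddfN. Qed.

Lemma wedge_withD N f (u v : ext_alg N) : wedge_with f (u + v) = wedge_with f u + wedge_with f v.
Proof. exact: raddfD. Qed.

Lemma coef_map_is_additive N (g : {additive S -> S}) : additive (@coef_map N g).
Proof.
elim: N => [|N IH] u v /=; first by rewrite raddfB.
by case: u v => [u u'] [v v']; rewrite ext_pairN ext_pairD /= !IH.
Qed.

HB.instance Definition _ N (g : {additive S -> S}) :=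
  GRing.isAdditive.Build (ext_alg N) (ext_alg N) (@coef_map N g) (coef_map_is_additive g).

Lemma contract_sq N f (u : ext_alg N) : contract f (contract f u) = 0.
Proof.
elim: N f u => [|N IH] f u //=; rewrite ext_pair0; congr (_, _).
  by rewrite scalerN contractD contractZ IH addr0 addNr.
by rewrite contractN IH !oppr0.
Qed.

Lemma contract_anti N f g (u : ext_alg N) :
  contract f (contract g u) = - contract g (contract f u).
Proof.
elim: N f g u => [|N IH] f g u /=; first by rewrite oppr0.
rewrite ext_pairN; congr (_, _); last by rewrite !contractN !opprK IH.
rewrite !scalerN !contractD !contractZ (IH (shift f)) !opprD opprK addrA.
by rewrite addrCA addrA.
Qed.

(** The antiderivation rule. It makes [wedge_with w] a contracting homotopy for [contract f] up to
    the factor [dotp N f w]. *)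
Lemma clifford N f w (u : ext_alg N) :
  contract f (wedge_with w u) = dotp N f w *: u - wedge_with w (contract f u).
Proof.
elim: N f w u => [|N IH] f w u /=; first by rewrite /dotp big_ord0 scale0r subr0.
rewrite dotpS; case: u => u v; rewrite ext_pairZ ext_pairN ext_pairD /=; congr (_, _).
  by rewrite IH wedge_withD wedge_withZ scalerBr scalerA scalerDl opprD addrACA.
rewrite contractD contractN contractZ IH wedge_withN opprK scalerDr scalerA.
rewrite (mulrC (w 0)) scalerDl; set A := (f 0 * _) *: v; set B := dotp _ _ _ *: v; set C := w 0 *: _.
by rewrite opprB -(addrA A C) (opprD A) addrACA subrr add0r opprD [RHS]addrA addrAC.
Qed.

Lemma contract_suml N (I : finType) (c : I -> S) (f : I -> nat -> S) (u : ext_alg N) :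
  contract (fun j => \sum_i c i * f i j) u = \sum_i c i *: contract (f i) u.
Proof.
elim: N f u => [|N IH] f u /=; first by rewrite big1 // => i _; rewrite scaler0.
case: u => u v /=; rewrite [LHS]/=.
have -> : \sum_i c i *: ((f i 0 *: v + contract (shift (f i)) u, - contract (shift (f i)) v) : ext_alg N.+1) =
  (\sum_i c i *: (f i 0 *: v + contract (shift (f i)) u), \sum_i c i *: (- contract (shift (f i)) v)).
  by elim/big_rec3: _ => // i x y z _ ->.
rewrite /shift !IH; congr (_, _).
  rewrite scaler_suml -big_split; apply: eq_bigr => i _ /=.
  by rewrite scalerDr scalerA.
by rewrite -sumrN; apply: eq_bigr => i _; rewrite scalerN.
Qed.

Lemma eq_contract N f g (u : ext_alg N) :
  (forall j, (j < N)%N -> f j = g j) -> contract f u = contract g u.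
Proof.
elim: N f g u => [|N IH] f g u //= e; rewrite e //.
by congr (_ + _, - _); apply: IH => j lt; apply: e.
Qed.

Lemma contract_fun0 N (u : ext_alg N) : contract (fun=> 0) u = 0.
Proof. by elim: N u => //= N IH u; rewrite -/(fun=> 0) !IH scale0r addr0 oppr0. Qed.

(** Having two maps [g] and [g'] covers homogeneous components, where multiplication by [f j] shifts
    the degree. *)
Lemma coef_map_contract N (g g' : {additive S -> S}) f f' (u : ext_alg N) :
  (forall j s, g (f j * s) = f' j * g' s) ->
  coef_map g (contract f u) = contract f' (coef_map g' u).
Proof.
move=> E; have EZ M c c' (v : ext_alg M) : (forall s, g (c * s) = c' * g' s) ->
    coef_map g (c *: v) = c' *: coef_map g' v.
  by move=> e; elim: M v => [|M IH] v /=; [exact: e | rewrite !IH].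
elim: N f f' u E => [|N IH] f f' u E /=; first exact: raddf0.
rewrite raddfD raddfN /= (EZ _ _ (f' 0)) // !(IH (shift f) (shift f')) // => j s; exact: E.
Qed.

Lemma coef_map_wedge N (g g' : {additive S -> S}) f f' (u : ext_alg N) :
  (forall j s, g (f j * s) = f' j * g' s) ->
  coef_map g (wedge_with f u) = wedge_with f' (coef_map g' u).
Proof.
move=> E; have EZ M c c' (v : ext_alg M) : (forall s, g (c * s) = c' * g' s) ->
    coef_map g (c *: v) = c' *: coef_map g' v.
  by move=> e; elim: M v => [|M IH] v /=; [exact: e | rewrite !IH].
elim: N f f' u E => [|N IH] f f' u E /=; first exact: raddf0.
rewrite raddfB /= (EZ _ _ (f' 0)) // !(IH (shift f) (shift f')) // => j s; exact: E.
Qed.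

Lemma coef_mapZ N (g g' : {additive S -> S}) c c' (u : ext_alg N) :
  (forall s, g (c * s) = c' * g' s) -> coef_map g (c *: u) = c' *: coef_map g' u.
Proof. by move=> e; elim: N u => [|N IH] u /=; [exact: e | rewrite !IH]. Qed.

Lemma coef_map_decomp N (g h : S -> S) c (u : ext_alg N) :
  (forall s, s = c * g s + h s) -> u = c *: coef_map g u + coef_map h u.
Proof.
move=> e; elim: N u => [|N IH] u /=; first exact: e.
by case: u => u v; rewrite ext_pairZ ext_pairD /= -!IH.
Qed.

Lemma coef_map_comp N (g h k : S -> S) (u : ext_alg N) :
  (forall s, g (h s) = k s) -> coef_map g (coef_map h u) = coef_map k u.
Proof.
by move=> e; elim: N u => [|N IH] u /=; rewrite ?IH // ; apply: e.
Qed.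

Lemma coef_map_fun0 N (u : ext_alg N) : coef_map (fun=> 0) u = 0.
Proof. by elim: N u => //= N IH u; rewrite !IH. Qed.

Lemma coef_map_id N (u : ext_alg N) : coef_map id u = u.
Proof. by elim: N u => //= N IH [u v]; rewrite !IH. Qed.

Lemma eq_coef_map N (g h : S -> S) (u : ext_alg N) : g =1 h -> coef_map g u = coef_map h u.
Proof. by move=> e; elim: N u => [|N IH] u /=; rewrite ?IH // e. Qed.

Lemma ext_scaler_eq0 N c (u : ext_alg N) : c != 0 -> c *: u = 0 -> u = 0.
Proof.
move=> nz; elim: N u => [|N IH] u.
  by move/eqP; rewrite [c *: _ == _]mulf_eq0 (negPf nz) => /eqP.
by case: u => u v [/IH -> /IH ->].
Qed.

Lemma contract_vacuum N f c : contract f (vacuum N c) = 0.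
Proof.
elim: N f => [|N IH] f //=; rewrite IH scaler0 addr0 linear0 oppr0 //.
Qed.

Lemma vacuumZ N c d : c *: vacuum N d = vacuum N (c * d).
Proof. by elim: N => //= N <-; rewrite ext_pairZ scaler0. Qed.

Lemma vacuumD N c d : vacuum N (c + d) = vacuum N c + vacuum N d.
Proof. by elim: N => //= N ->; rewrite ext_pairD addr0. Qed.

Lemma vacuum0 N : vacuum N 0 = 0.
Proof. by elim: N => //= N ->. Qed.

Lemma coef_map_vacuum N (g : {additive S -> S}) c : coef_map g (vacuum N c) = vacuum N (g c).
Proof. by elim: N => //= N ->; rewrite raddf0. Qed.

Lemma coef0_vacuum N c : coef0 (vacuum N c) = c.
Proof. by elim: N. Qed.

Lemma coef0_contract N f (u : ext_alg N) :
  coef0 (contract f u) = \sum_(j < N) f j * coef1 u j.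
Proof.
have L M a (x y : ext_alg M) : coef0 (a *: x + y) = a * coef0 x + coef0 y.
  by elim: M x y => //= M IH x y; apply: IH.
elim: N f u => [|N IH] f u /=; first by rewrite big_ord0.
by rewrite L IH big_ord_recl.
Qed.

End ExteriorAlgebra.


(** * Setting variables to zero and dividing by a variable *)

Section Elimination.
Variables (R : fieldType) (n : nat).
Local Notation S := {mpoly R[n]}.
Implicit Types (P : pred 'I_n) (f g : S).

(* Reduction modulo the variables in P, as an endomorphism of the ring. *)
Definition kill P (f : S) : S :=
  f \mPo [tuple if P i then 0 else 'X_i | i < n].

Lemma kill_is_additive P : additive (kill P).
Proof. exact: comp_mpoly_is_additive. Qed.

HB.instance Definition _ P := GRing.isAdditive.Build S S (kill P) (kill_is_additive P).

Lemma killZ P c f : kill P (c *: f) = c *: kill P f.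
Proof. exact: comp_mpolyZ. Qed.

Lemma killM P f g : kill P (f * g) = kill P f * kill P g.
Proof. exact: rmorphM. Qed.

Lemma kill_var P i : kill P 'X_i = if P i then 0 else 'X_i.
Proof. by rewrite /kill comp_mpolyXU -tnth_nth tnth_mktuple. Qed.

Lemma kill_monomial P m :
  kill P 'X_[m] = if [forall i, P i ==> (m i == 0)] then 'X_[m] else 0.
Proof.
rewrite /kill comp_mpolyX; case: forallP => [h|/forallP].
  rewrite [RHS]mpolyXE_id; apply: eq_bigr => i _; rewrite tnth_mktuple.
  by have := h i; case: (P i) => //= /eqP ->; rewrite !expr0.
rewrite negb_forall => /existsP[i]; rewrite negb_imply => /andP[Pi mi].
by rewrite (bigD1 i) //= tnth_mktuple Pi expr0n (negPf mi) mul0r.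
Qed.

Lemma kill_kill P Q f : kill P (kill Q f) = kill (predU P Q) f.
Proof.
elim/mpolyind: f => [|c m f _ _ IH]; first by rewrite !raddf0.
rewrite !raddfD /= IH; congr (_ + _); rewrite !killZ; congr (_ *: _).
rewrite !kill_monomial.
case: forallP => [hQ|nQ]; last first.
  rewrite raddf0; case: forallP => // h; case: nQ => i; apply/implyP => Qi.
  by have := h i; rewrite /= Qi orbT.
rewrite kill_monomial; case: forallP => [hP|nP]; case: forallP => h //.
  by case: h => i; apply/implyP => /orP[Pi|Qi]; [have := hP i; rewrite Pi | have := hQ i; rewrite Qi].
by case: nP => i; have := h i; rewrite /=; case: (P i) => //.
Qed.

Lemma eq_kill P Q f : P =1 Q -> kill P f = kill Q f.
Proof.
by move=> e; congr (_ \mPo _); apply: eq_from_tnth => i; rewrite !tnth_mktuple e.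
Qed.

Lemma kill_pihomog P d f : kill P (pihomog mdeg d f) = pihomog mdeg d (kill P f).
Proof.
elim/mpolyind: f => [|c m f _ _ IH]; first by rewrite !raddf0.
rewrite !raddfD /= IH; congr (_ + _); rewrite linearZ /= !killZ linearZ /=.
congr (_ *: _); rewrite kill_monomial pihomogX.
by case: ifP => hm; case: ifP => hP; rewrite ?kill_monomial ?hP ?raddf0 ?pihomogX ?hm.
Qed.

Lemma kill_all_homog d f : (0 < d)%N -> f \is d.-homog -> kill predT f = 0.
Proof.
move=> d0 hf; rewrite [f]mpolyE raddf_sum big_seq big1 // => m mf /=.
rewrite killZ kill_monomial; case: forallP => [h|]; last by rewrite scaler0.
move: d0; rewrite -(dhomogP _ _ _ hf _ mf) /= mdegE big1 // => i _.
exact/eqP/(h i).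
Qed.

Definition var_quot (i : 'I_n) (f : S) : S :=
  \sum_(m <- msupp f) f@_m *: (if (0 < m i)%N then 'X_[m - U_(i)] else 0).

Lemma var_quotE i f : f = 'X_i * var_quot i f + kill (pred1 i) f.
Proof.
rewrite {1 3}[f]mpolyE raddf_sum mulr_sumr -big_split; apply: eq_bigr => m _ /=.
rewrite killZ kill_monomial -scalerAr -scalerDr; congr (_ *: _).
case: posnP => [mi|mi].
  rewrite mulr0 add0r; case: forallP => // -[] l; apply/implyP => /= /eqP ->.
  exact/eqP.
rewrite -mpolyXD addmC submK ?lep1mP -?lt0n //.
case: forallP => [/(_ i)|]; last by rewrite addr0.
by rewrite /= eqxx /= gtn_eqF.
Qed.

Lemma var_quot_is_additive i : additive (var_quot i).
Proof.
move=> f g; apply: (@mulfI _ 'X_i); first by rewrite -msupp_eq0 msuppX.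
apply: (@addIr _ (kill (pred1 i) (f - g))).
rewrite -var_quotE raddfB /= mulrBr addrACA -opprD -!var_quotE //.
Qed.

HB.instance Definition _ i := GRing.isAdditive.Build S S (var_quot i) (var_quot_is_additive i).

Lemma mpolyX_neq0 m : 'X_[m] != 0 :> S.
Proof. by rewrite -msupp_eq0 msuppX. Qed.

End Elimination.

(** * The exterior algebra modulo a set of variables *)

Section Vanishing.
Variables (R : fieldType) (n N : nat).
Local Notation S := {mpoly R[n]}.
Local Notation E := (ext_alg S N).
Implicit Types (P : pred 'I_n) (u v : E).

(** Being zero over S / (x_i, i in P), expressed without forming the quotient ring. *)
Definition vanishes P u := coef_map (kill P) u = 0.
Definition homog_part d u : E := coef_map (pihomog mdeg d) u.

Lemma vanishes0 P : vanishes P 0. Proof. exact: raddf0. Qed.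

Lemma vanishesD P u v : vanishes P u -> vanishes P v -> vanishes P (u + v).
Proof. by rewrite /vanishes raddfD /= => -> ->; rewrite addr0. Qed.

Lemma vanishesN P u : vanishes P u -> vanishes P (- u).
Proof. by rewrite /vanishes raddfN /= => ->; rewrite oppr0. Qed.

Lemma vanishesB P u v : vanishes P u -> vanishes P v -> vanishes P (u - v).
Proof. by move=> hu hv; apply/vanishesD/vanishesN. Qed.

Lemma coef_map_killZ P (c : S) u : coef_map (kill P) (c *: u) = kill P c *: coef_map (kill P) u.
Proof. by apply: coef_mapZ => s; exact: killM. Qed.

Lemma vanishesZ P c u : vanishes P u -> vanishes P (c *: u).
Proof. by rewrite /vanishes coef_map_killZ => ->; rewrite scaler0. Qed.

Lemma vanishes_sum P (I : Type) (r : seq I) (Q : pred I) (F : I -> E) :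
  (forall i, Q i -> vanishes P (F i)) -> vanishes P (\sum_(i <- r | Q i) F i).
Proof. by move=> h; apply: big_ind => //; [apply: vanishes0 | move=> x y; apply: vanishesD]. Qed.

Lemma vanishes_contract P f u : vanishes P u -> vanishes P (contract f u).
Proof.
move=> hu; rewrite /vanishes (coef_map_contract (f' := fun j => kill P (f j)) (g' := kill P)).
  by rewrite hu linear0.
by move=> j s; exact: killM.
Qed.

Lemma vanishes_wedge P f u : vanishes P u -> vanishes P (wedge_with f u).
Proof.
move=> hu; rewrite /vanishes (coef_map_wedge (f' := fun j => kill P (f j)) (g' := kill P)).
  by rewrite hu linear0.
by move=> j s; exact: killM.
Qed.

(** Modulo the variables in P there remains a polynomial ring, hence a domain. *)
Lemma vanishes_cancel P c u : kill P c != 0 -> vanishes P (c *: u) -> vanishes P u.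
Proof. by rewrite /vanishes coef_map_killZ => nz; apply: ext_scaler_eq0. Qed.

Lemma vanishes_mul P c u : kill P c = 0 -> vanishes P (c *: u).
Proof. by rewrite /vanishes coef_map_killZ => ->; rewrite scale0r. Qed.

Lemma vanishes_predU1 P i u : vanishes (predU P (pred1 i)) u ->
  vanishes P (u - 'X_i *: coef_map (var_quot i) u).
Proof.
move=> hu; rewrite {1}(coef_map_decomp u (var_quotE i)) addrC addKr /vanishes.
by rewrite (coef_map_comp (k := kill (predU P (pred1 i)))) //; apply: kill_kill.
Qed.

Lemma eq_vanishes P Q u : P =1 Q -> vanishes P u -> vanishes Q u.
Proof.
by move=> e; rewrite /vanishes => <-; apply/esym/eq_coef_map => s; apply: eq_kill.
Qed.

Lemma vanishes_homog_part P d u : vanishes P u -> vanishes P (homog_part d u).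
Proof.
rewrite /vanishes /homog_part => hu.
rewrite (coef_map_comp (k := fun s => pihomog mdeg d (kill P s))); last exact: kill_pihomog.
by rewrite -(coef_map_comp (g := pihomog mdeg d) (h := kill P)) // hu raddf0.
Qed.

Lemma homog_partK d u : homog_part d (homog_part d u) = homog_part d u.
Proof. by apply: coef_map_comp => s; rewrite pihomog_id. Qed.

Lemma homog_part_vanishes d u : (0 < d)%N -> homog_part d u = u -> vanishes predT u.
Proof.
move=> d0 hu; rewrite /vanishes -hu (coef_map_comp (k := fun=> 0)); last first.
  by move=> s; apply: kill_all_homog (pihomogP _ _ _).
exact: coef_map_fun0.
Qed.

Lemma homog_partZ e d c u : c \is e.-homog ->
  homog_part (e + d) (c *: u) = c *: homog_part d u.
Proof. by move=> hc; apply: coef_mapZ => s; apply: pihomogMl. Qed.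

Lemma homog_part_contract e d f u : (forall j, f j \is e.-homog) ->
  homog_part (e + d) (contract f u) = contract f (homog_part d u).
Proof. by move=> hf; apply: coef_map_contract => j s; apply: pihomogMl. Qed.

End Vanishing.

(** * The Buchsbaum-Rim complex *)

Section BuchsbaumRim.
Variables (R : fieldType) (n N : nat).
Local Notation S := {mpoly R[n]}.
Local Notation E := (ext_alg S N).
Local Notation D := ('X_{1..n} -> E).
(** The matrix of a map of free modules from S^N into the kernel of delta_1 in S^n. Its i-th row is
    a functional on S^N and acts on the exterior algebra by [ia i]. *)
Variable alpha : 'I_n -> nat -> S.
Hypothesis alpha_homog : forall i j, alpha i j \is 1.-homog.
Hypothesis alpha_koszul : forall j, \sum_i 'X_i * alpha i j = 0.
Implicit Types (u v : E) (y z : D) (P : pred 'I_n).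

Local Notation ia i := (contract (alpha i)).

Lemma koszul_contract u : \sum_i 'X_i *: ia i u = 0.
Proof.
rewrite -contract_suml (eq_contract (g := fun=> 0)); last by move=> j _; apply: alpha_koszul.
exact: contract_fun0.
Qed.

Lemma koszul_contract_except i u :
  'X_i *: ia i u = - \sum_(l | l != i) 'X_l *: ia l u.
Proof. by apply/eqP; rewrite -addr_eq0; move: (koszul_contract u); rewrite (bigD1 i) //= => ->. Qed.

Definition contract_list (s : seq 'I_n) u : E := foldl (fun v i => ia i v) u s.

Lemma contract_listZ s c u : contract_list s (c *: u) = c *: contract_list s u.
Proof. by elim: s u => //= i s IH u; rewrite contractZ IH. Qed.

Lemma contract_listD s u v : contract_list s (u + v) = contract_list s u + contract_list s v.
Proof. by elim: s u v => //= i s IH u v; rewrite contractD IH. Qed.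

Lemma contract_listN s u : contract_list s (- u) = - contract_list s u.
Proof. by rewrite -scaleN1r contract_listZ scaleN1r. Qed.

Lemma contract_list_comm s i u :
  contract_list s (ia i u) = (-1) ^+ size s *: ia i (contract_list s u).
Proof.
elim: s u => [|l s IH] u /=; first by rewrite scale1r.
by rewrite contract_anti contract_listN IH exprS mulN1r scaleNr.
Qed.

Lemma contract_list_rem s i : i \in s ->
  exists b : bool, forall u, contract_list s u = (-1) ^+ b *: ia i (contract_list (rem i s) u).
Proof.
elim: s => [//|l s IH]; rewrite inE /=; case: eqP => [<- _|/eqP ne] /=.
  by rewrite eqxx; exists (odd (size s)) => u; rewrite contract_list_comm signr_odd.
by move/IH => [b Hb]; exists b => u; rewrite eq_sym (negPf ne) Hb.
Qed.

Lemma contract_list_eq0 s i u : i \in s -> ia i (contract_list s u) = 0.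
Proof. by move/contract_list_rem => [b ->]; rewrite contractZ contract_sq scaler0. Qed.

Lemma contract_list_eq0' s i u : i \in s -> contract_list s (ia i u) = 0.
Proof. by move=> si; rewrite contract_list_comm contract_list_eq0 ?scaler0. Qed.

Lemma vanishes_contract_list P s u : vanishes P u -> vanishes P (contract_list s u).
Proof. by elim: s u => //= i s IH u hu; apply/IH/vanishes_contract. Qed.

Lemma homog_part_contract_list d s u :
  homog_part (size s + d) (contract_list s u) = contract_list s (homog_part d u).
Proof.
elim: s d u => //= i s IH d u; rewrite addSnnS IH.
by rewrite -(homog_part_contract d u (alpha_homog i)).
Qed.

Definition others (i : 'I_n) : seq 'I_n := rem i (enum 'I_n).

Lemma mem_others i l : (l \in others i) = (l != i).
Proof. by rewrite mem_rem_uniq ?enum_uniq // inE mem_enum andbT. Qed.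

Lemma others_uniq i : uniq (others i).
Proof. exact/rem_uniq/enum_uniq. Qed.

Lemma size_others i : size (others i) = n.-1.
Proof. by rewrite size_rem ?mem_enum // size_enum_ord. Qed.

Lemma rem_rem (s : seq 'I_n) i l : uniq s -> rem i (rem l s) = rem l (rem i s).
Proof.
move=> us; rewrite !rem_filter ?filter_uniq // -!filter_predI.
by apply: eq_filter => x; rewrite /= andbC.
Qed.

(** In the product, x_l [ia l] is replaced by minus the sum of the other x_m [ia m]; all terms but m
    = i die because [ia m] occurs already and squares to zero. *)
Lemma contract_others i l : exists b : bool, forall u,
  'X_l *: contract_list (others i) u = (-1) ^+ b *: ('X_i *: contract_list (others l) u).
Proof.
have [->|ne] := eqVneq l i; first by exists false => u; rewrite scale1r.
have il : i != l by rewrite eq_sym.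
have [b Hb] := @contract_list_rem (others i) l (etrans (mem_others _ _) ne).
have [c Hc] := @contract_list_rem (others l) i (etrans (mem_others _ _) il).
exists (~~ (b (+) c)) => u; rewrite Hb Hc {Hb Hc} /others (@rem_rem _ l i) ?enum_uniq //.
set v := contract_list _ u.
have e : 'X_l *: ia l v = - ('X_i *: ia i v).
  rewrite koszul_contract_except (bigD1 i) 1?eq_sym //= big1 ?addr0 // => m /andP[ml mi].
  rewrite contract_list_eq0 ?scaler0 // !(mem_rem_uniq, inE) ?rem_uniq ?enum_uniq //.
  by rewrite ml mi mem_enum.
rewrite scalerA mulrC -scalerA e (scalerA 'X_i) (mulrC 'X_i) -[in RHS]scalerA scalerA.
by case: b; case: c; rewrite /= ?expr1 ?expr0 ?mulN1r ?mulr1 ?mul1r ?opprK ?scaleN1r ?scale1r ?opprK ?scaleNr ?opprK.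
Qed.

Variables (o l0 : 'I_n).
Hypothesis l0_neq : l0 != o.

(* The map C_3 -> C_2, up to sign the product of all [ia l] with l <> i divided
   by 'X_i, for any i.  The exterior degree is not recorded: C_2 and C_3 are the
   whole exterior algebra. *)
Definition splice u : E := coef_map (var_quot o) (contract_list (others o) u).

Lemma var_neq0 i : 'X_i != 0 :> S. Proof. exact: mpolyX_neq0. Qed.

Lemma ext_cancel (c : S) u v : c != 0 -> c *: u = c *: v -> u = v.
Proof.
move=> nz /eqP; rewrite -subr_eq0 -scalerBr => /eqP/(ext_scaler_eq0 nz)/eqP.
by rewrite subr_eq0 => /eqP.
Qed.

(** The division in [splice] is exact: by [contract_others], x_l0 times the product over [others o]
    vanishes modulo x_o, and x_l0 can be cancelled there. *)
Lemma splice_others i : exists b : bool, forall u,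
  'X_i *: splice u = (-1) ^+ b *: contract_list (others i) u.
Proof.
have main u : 'X_o *: splice u = contract_list (others o) u.
  rewrite [RHS](coef_map_decomp _ (var_quotE o)) -/(splice u).
  suff -> : coef_map (kill (pred1 o)) (contract_list (others o) u) = 0 by rewrite addr0.
  apply: (@ext_cancel 'X_l0); first exact: var_neq0.
  have kl : kill (pred1 o) 'X_l0 = 'X_l0 :> S by rewrite kill_var /= (negPf l0_neq).
  rewrite scaler0 -kl -coef_map_killZ.
  have [b ->] := contract_others o l0.
  by rewrite scalerA mulrC -scalerA coef_map_killZ kill_var /= eqxx scale0r.
have [b Hb] := contract_others o i; exists b => u.
apply: (@ext_cancel 'X_o); first exact: var_neq0.
by rewrite scalerA mulrC -scalerA main Hb scalerA mulrC -scalerA.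
Qed.

Lemma spliceZ c u : splice (c *: u) = c *: splice u.
Proof.
have [b Hb] := splice_others o; apply: (@ext_cancel 'X_o); first exact: var_neq0.
by rewrite Hb contract_listZ scalerA mulrC -scalerA -Hb scalerA mulrC -scalerA.
Qed.

Lemma spliceD u v : splice (u + v) = splice u + splice v.
Proof. by rewrite /splice contract_listD raddfD. Qed.

Lemma splice0 : splice 0 = 0.
Proof. by have := spliceZ 0 0; rewrite !scale0r. Qed.

Lemma spliceB u v : splice (u - v) = splice u - splice v.
Proof. by rewrite -scaleN1r spliceD spliceZ scaleN1r. Qed.

Lemma splice_sum (I : Type) (r : seq I) (Q : pred I) (F : I -> E) :
  splice (\sum_(i <- r | Q i) F i) = \sum_(i <- r | Q i) splice (F i).
Proof. exact: (big_morph splice spliceD splice0). Qed.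

(** Computing [splice] through some l <> i makes [ia i] one of the factors of the product; the same
    choice proves [splice_contract]. *)
Lemma contract_splice i u : ia i (splice u) = 0.
Proof.
have [l li] : exists l : 'I_n, i != l.
  by have [->|ne] := eqVneq i o; [exists l0; rewrite eq_sym | exists o].
have [b Hb] := splice_others l; apply: (@ext_cancel 'X_l); first exact: var_neq0.
by rewrite -contractZ Hb contractZ contract_list_eq0 ?mem_others // !scaler0.
Qed.

Lemma splice_contract i u : splice (ia i u) = 0.
Proof.
have [l li] : exists l : 'I_n, i != l.
  by have [->|ne] := eqVneq i o; [exists l0; rewrite eq_sym | exists o].
have [b Hb] := splice_others l; apply: (@ext_cancel 'X_l); first exact: var_neq0.
by rewrite Hb contract_list_eq0' ?mem_others // !scaler0.
Qed.

Lemma vanishes_splice P u : (exists i, ~~ P i) -> vanishes P u -> vanishes P (splice u).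
Proof.
case=> i nPi hu; have [b Hb] := splice_others i.
apply: (@vanishes_cancel _ _ _ _ 'X_i); first by rewrite kill_var (negPf nPi) var_neq0.
by rewrite Hb; apply/vanishesZ/vanishes_contract_list.
Qed.

Lemma vanishes_of_splice P i u : vanishes P (splice u) -> vanishes P (contract_list (others i) u).
Proof.
have [b Hb] := splice_others i => /(vanishesZ 'X_i); rewrite Hb.
by move/(vanishesZ ((-1) ^+ b)); rewrite scalerA -expr2 sqrr_sign scale1r.
Qed.

(** There are n - 1 linear contractions, and one variable is divided out. *)
Lemma homog_part_splice d u : homog_part (n - 2 + d) (splice u) = splice (homog_part d u).
Proof.
have [b Hb] := splice_others o; apply: (@ext_cancel 'X_o); first exact: var_neq0.
have hX : ('X_o : S) \is 1.-homog by rewrite dhomogX; apply/eqP/mdeg1.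
rewrite Hb -(homog_part_contract_list d) size_others -(homog_partZ _ _ hX) Hb.
have -> : (1 + (n - 2 + d) = n.-1 + d)%N.
  have : (1 < n)%N by case: (n) o l0 l0_neq => [[]|[|m]] // a b'; rewrite !ord1.
  by case: (n) => [|[|m]] //= _; rewrite subSS subSS subn0.
have h0 : ((-1) ^+ b : S) \is 0.-homog by case: b {Hb}; rewrite ?expr1 ?expr0 ?rpredN dhomog1.
by rewrite -{1}[(n.-1 + d)%N]add0n (homog_partZ _ _ h0).
Qed.

(* A function y : D stands for \sum_m y m (x) e^(m), where e^(m) is the basis of
   the divided power algebra of V^dual; [mula] is multiplication by the
   tautological element \sum_i x_i e_i, so that e_i e^(m) = (m_i + 1) e^(m + U_i). *)
Definition diff y : D := fun m => \sum_i ia i (y (m + U_(i))%MM).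
Definition mula y : D := fun m => \sum_i ('X_i *+ m i) *: y (m - U_(i))%MM.

Lemma diffZ c y m : diff (fun m' => c *: y m') m = c *: diff y m.
Proof. by rewrite /diff scaler_sumr; apply: eq_bigr => i _; rewrite contractZ. Qed.

Lemma diffD y z m : diff (fun m' => y m' + z m') m = diff y m + diff z m.
Proof. by rewrite /diff -big_split; apply: eq_bigr => i _; rewrite contractD. Qed.

Lemma diffN y m : diff (fun m' => - y m') m = - diff y m.
Proof. by rewrite /diff -sumrN; apply: eq_bigr => i _; rewrite contractN. Qed.

Lemma diffB y z m : diff (fun m' => y m' - z m') m = diff y m - diff z m.
Proof. by rewrite (diffD y) diffN. Qed.

Lemma mulaZ c y m : mula (fun m' => c *: y m') m = c *: mula y m.
Proof. by rewrite /mula scaler_sumr; apply: eq_bigr => i _; rewrite !scalerA mulrC. Qed.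

Lemma mulaD y z m : mula (fun m' => y m' + z m') m = mula y m + mula z m.
Proof. by rewrite /mula -big_split; apply: eq_bigr => i _; rewrite scalerDr. Qed.

Lemma mulaN y m : mula (fun m' => - y m') m = - mula y m.
Proof. by rewrite /mula -sumrN; apply: eq_bigr => i _; rewrite scalerN. Qed.

Lemma mulaB y z m : mula (fun m' => y m' - z m') m = mula y m - mula z m.
Proof. by rewrite (mulaD y) mulaN. Qed.

Lemma eq_diff y z m : (forall m', mdeg m' = (mdeg m).+1 -> y m' = z m') -> diff y m = diff z m.
Proof. by move=> e; apply: eq_bigr => i _; rewrite e // mdegD mdeg1 addn1. Qed.

Lemma vanishes_diff P y m : (forall m', mdeg m' = (mdeg m).+1 -> vanishes P (y m')) ->
  vanishes P (diff y m).
Proof.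
by move=> e; apply: vanishes_sum => i _; apply/vanishes_contract/e; rewrite mdegD mdeg1 addn1.
Qed.

Lemma mdeg_subU (m : 'X_{1..n}) (i : 'I_n) : (0 < m i)%N -> (mdeg (m - U_(i))%MM).+1 = mdeg m.
Proof.
move=> mi; have Um : (U_(i) <= m)%MM by rewrite lep1mP -lt0n.
by rewrite -[in RHS](submK Um) mdegD mdeg1 addn1.
Qed.

Lemma addU_subU (m : 'X_{1..n}) (i l : 'I_n) : (0 < m l)%N ->
  (m + U_(i) - U_(l))%MM = (m - U_(l) + U_(i))%MM.
Proof.
move=> ml; have Um : (U_(l) <= m)%MM by rewrite lep1mP -lt0n.
by rewrite [RHS]addmC addmBA // [in RHS]addmC.
Qed.

Lemma vanishes_mula P y m : (forall m', (mdeg m').+1 = mdeg m -> vanishes P (y m')) ->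
  vanishes P (mula y m).
Proof.
move=> e; apply: vanishes_sum => i _; have [->|mi] := posnP (m i).
  by rewrite mulr0n scale0r; apply: vanishes0.
by apply/vanishesZ/e/mdeg_subU.
Qed.

Lemma homog_part_diff d y m :
  diff (fun m' => homog_part d (y m')) m = homog_part d.+1 (diff y m).
Proof.
rewrite /diff [RHS]raddf_sum; apply: eq_bigr => i _ /=.
by rewrite -/(homog_part _ _) (homog_part_contract d _ (alpha_homog i)).
Qed.

Lemma homog_part_mula d y m :
  mula (fun m' => homog_part d (y m')) m = homog_part d.+1 (mula y m).
Proof.
rewrite /mula [RHS]raddf_sum; apply: eq_bigr => i _ /=.
rewrite -/(homog_part _ _) -add1n (homog_partZ d) // rpredMn // dhomogX.
exact/eqP/mdeg1.
Qed.

Lemma sum_antisym (V : zmodType) (G : 'I_n -> 'I_n -> V) :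
  (forall i, G i i = 0) -> (forall i l, G i l = - G l i) -> \sum_i \sum_l G i l = 0.
Proof.
move=> G0 GN; rewrite pair_bigA /= (bigID (fun p : 'I_n * 'I_n => (p.1 < p.2)%N)) /=.
rewrite [X in _ + X](bigID (fun p : 'I_n * 'I_n => (p.2 < p.1)%N)) /= [X in _ + (_ + X)]big1 => [|[i l]]; last first.
  by rewrite /= -!leqNgt andbC -eqn_leq => /eqP/val_inj ->.
rewrite addr0 [X in _ + X](reindex_inj (h := fun p : 'I_n * 'I_n => (p.2, p.1))) => [|[? ?] [? ?] [-> ->] //].
rewrite [X in _ + X](eq_bigl (fun p : 'I_n * 'I_n => (p.1 < p.2)%N)) => [|[i l]] /=.
  by rewrite -big_split big1 // => p _ /=; rewrite GN addNr.
by rewrite andb_idl // => /ltnW; rewrite leqNgt.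
Qed.

Lemma diff_diff y m : diff (diff y) m = 0.
Proof.
rewrite /diff; under eq_bigr do rewrite raddf_sum /=.
apply: sum_antisym => [i|i l]; first exact: contract_sq.
by rewrite contract_anti -!addmA [(U_(l) + _)%MM]addmC.
Qed.

(** The commutator is the sum of the x_i [ia i] applied to [y m], which is zero by the Koszul
    relation. *)
Lemma diff_mula y m : diff (mula y) m = mula (diff y) m.
Proof.
rewrite /diff /mula; under eq_bigr do rewrite raddf_sum /=.
under [RHS]eq_bigr do rewrite scaler_sumr.
apply/eqP; rewrite [X in _ == X]exchange_big -subr_eq0 -sumrB /=.
rewrite -[X in _ == X](koszul_contract (y m)); apply/eqP/eq_bigr => i _.
rewrite -sumrB (bigD1 i) //= big1 => [|l li].
  rewrite addr0 contractZ mnmDE mnm1E eqxx addn1 addmK mulrS scalerDl.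
  have [->|mi] := posnP (m i); first by rewrite mulr0n !scale0r subr0 addr0.
  by rewrite submK ?lep1mP -?lt0n // addrK.
rewrite contractZ mnmDE mnm1E eq_sym (negPf li) addn0.
have [->|ml] := posnP (m l); first by rewrite mulr0n !scale0r subr0.
by rewrite addU_subU // subrr.
Qed.


(** * Exactness after inverting a variable and a minor *)

Section LocalExactness.
(** Where [delta] is invertible, the rows of [alpha] other than the one at [i0] are independent,
    with dual family [beta]. Localization is expressed by multiplying with powers of [delta] and
    x_i0. *)
Variables (P : pred 'I_n) (i0 : 'I_n) (beta : 'I_n -> nat -> S) (delta : S).
Hypothesis dual_basis : forall i l, i != i0 -> l != i0 ->
  dotp N (alpha i) (beta l) = if i == l then delta else 0.

Local Notation wb l := (wedge_with (beta l)).
Local Notation x0 := ('X_i0 : S).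

Lemma contract_wb i l u : i != i0 -> l != i0 -> i != l ->
  ia i (wb l u) = - wb l (ia i u).
Proof. by move=> hi hl il; rewrite clifford dual_basis // (negPf il) scale0r add0r. Qed.

Lemma contract_wb_same l u : l != i0 -> ia l (wb l u) = delta *: u - wb l (ia l u).
Proof. by move=> hl; rewrite clifford dual_basis // eqxx. Qed.

(** The induction hypothesis applies to [ia i u]. Wedging its conclusion with [beta i], which
    anticommutes with the other contractions, recovers [delta] times u up to the image of [ia i]. *)
Lemma vanishes_contract_list_image s u : uniq s -> i0 \notin s ->
  vanishes P (contract_list s u) ->
  exists v : 'I_n -> E, vanishes P (delta ^+ size s *: u - \sum_(i <- s) ia i (v i)).
Proof.
elim: s u => [|i s IH] u /=.
  by move=> _ _ hu; exists (fun=> 0); rewrite big_nil subr0 scale1r.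
move=> /andP[nis us]; rewrite inE negb_or => /andP[i0i i0s] hu.
have [v hv] := IH _ us i0s hu.
have ii0 : i != i0 by rewrite eq_sym.
pose v' l := if l == i then delta ^+ size s *: wb i u else - wb i (v l).
exists v'; rewrite big_cons {1}/v' eqxx.
have -> : \sum_(j <- s) ia j (v' j) = wb i (\sum_(j <- s) ia j (v j)).
  rewrite raddf_sum big_seq [RHS]big_seq; apply: eq_bigr => j js /=.
  have ji : j != i by apply: contraNneq nis => <-.
  have ji0 : j != i0 by apply: contraNneq i0s => <-.
  by rewrite /v' (negPf ji) contractN (contract_wb _ ji0 ii0 ji) opprK.
have := vanishes_wedge (beta i) hv; rewrite wedge_withD wedge_withN wedge_withZ.
set w := wb i (\sum_(_ <- _) _) => hw.
rewrite contractZ contract_wb_same // scalerBr scalerA -exprSr opprD opprB addrA.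
by rewrite [_ *: u + _]addrC subrK.
Qed.

Lemma splice_kernel u : vanishes P (splice u) ->
  exists v : 'I_n -> E, vanishes P (delta ^+ n.-1 *: u - \sum_i ia i (v i)).
Proof.
move/(vanishes_of_splice i0)/(vanishes_contract_list_image (others_uniq i0)).
rewrite mem_others eqxx size_others => /(_ isT)[v hv].
exists (fun i => if i == i0 then 0 else v i); rewrite (bigD1 i0) //= eqxx linear0 add0r.
rewrite (eq_bigr (fun i => ia i (v i))) => [|i /negPf->] //.
by move: hv; rewrite big_uniq ?others_uniq //= (eq_bigl (fun i => i != i0)) // => i; apply: mem_others.
Qed.

Definition wedge_list (s : seq 'I_n) u : E := foldr (fun i => wb i) u s.

Lemma contract_wedge_list s i u : i != i0 -> i \notin s -> i0 \notin s ->
  vanishes P (ia i u) -> vanishes P (ia i (wedge_list s u)).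
Proof.
move=> ii0; elim: s => [//|l s IH] /=; rewrite !inE !negb_or => /andP[il ins] /andP[i0l i0s] hu.
rewrite contract_wb //; last by rewrite eq_sym.
apply/vanishesN/vanishes_wedge; exact: IH.
Qed.

Lemma contract_list_wedge_list s u : uniq s -> i0 \notin s ->
  (forall i, i \in s -> vanishes P (ia i u)) ->
  vanishes P (contract_list s (wedge_list s u) - delta ^+ size s *: u).
Proof.
elim: s => [|i s IH] /=; first by rewrite scale1r subrr => *; apply: vanishes0.
rewrite inE negb_or => /andP[ins us] /andP[i0i i0s] hu.
have ii0 : i != i0 by rewrite eq_sym.
rewrite contract_wb_same // contract_listD contract_listN contract_listZ addrAC exprS -scalerA -scalerBr.
apply: vanishesB.
  by apply/vanishesZ/IH => // l ls; apply: hu; rewrite inE ls orbT.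
apply/vanishes_contract_list/vanishes_wedge/contract_wedge_list => //.
by apply: hu; rewrite mem_head.
Qed.

(** Wedging u with all the [beta i] and contracting again multiplies u by a power of [delta], as
    every [ia i] kills u; the product of contractions is x_i0 times [splice] up to sign. *)
Lemma contract_kernel u : (forall i, vanishes P (ia i u)) ->
  exists y : E, vanishes P (delta ^+ n.-1 *: u - splice y).
Proof.
move=> hu; have i0o : i0 \notin others i0 by rewrite mem_others eqxx.
have := contract_list_wedge_list (others_uniq i0) i0o (fun i _ => hu i).
rewrite size_others; set w := wedge_list _ u => hw.
have [b Hb] := splice_others i0; exists (((-1) ^+ b * 'X_i0) *: w).
rewrite spliceZ -scalerA Hb scalerA -expr2 sqrr_sign scale1r -opprB.
exact: vanishesN.
Qed.

(** The coordinates other than [i0] are reached through the dual family; the one at [i0] then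
    follows from the Koszul relation on cancelling x_i0. *)
Lemma koszul_kernel (z : 'I_n -> S) : \sum_i 'X_i * z i = 0 ->
  exists u, forall i, delta *: vacuum N (z i) = ia i u.
Proof.
move=> hz; pose u := \sum_(l | l != i0) z l *: wb l (vacuum N 1).
exists u.
have main i : i != i0 -> ia i u = delta *: vacuum N (z i).
  move=> ii0; rewrite /u raddf_sum /= (bigD1 i) //= big1 ?addr0 => [|l /andP[li0 li]].
    rewrite contractZ contract_wb_same // contract_vacuum linear0 subr0 scalerA mulrC.
    by rewrite -scalerA vacuumZ mulr1.
  have il : i != l by rewrite eq_sym.
  by rewrite contractZ contract_wb // contract_vacuum linear0 oppr0 scaler0.
move=> i; have [->|ii0] := eqVneq i i0; last by rewrite main.
apply: (@ext_cancel x0); first exact: var_neq0.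
rewrite koszul_contract_except (eq_bigr (fun l => delta *: vacuum N ('X_l * z l))); last first.
  by move=> l li0; rewrite main // scalerA mulrC -scalerA vacuumZ.
rewrite -scaler_sumr -(big_morph _ (@vacuumD _ N) (@vacuum0 _ N)).
rewrite scalerA mulrC -scalerA vacuumZ -scalerN; congr (_ *: _).
move: hz; rewrite (bigD1 i0) //= => /eqP; rewrite addr_eq0 => /eqP ->.
by rewrite -scaleN1r vacuumZ mulN1r.
Qed.

(* [delta] times the identity is homotopic to the projection onto the
   exponents with [m l = 0] followed by [wb l \o ia l]. *)
Definition homotopy l y : D := fun m => if (0 < m l)%N then wb l (y (m - U_(l))%MM) else 0.
Definition residue l y : D := fun m => if (0 < m l)%N then 0 else wb l (ia l (y m)).

(** In the sum over i, the term i = l is the Clifford relation, and the terms i <> l, i0 cancel by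
    anticommutation. The term i = i0 involves y only at exponents containing [i0], where y is
    zero. *)
Lemma homotopyE j l y m : l != i0 -> mdeg m = j ->
    (forall m', mdeg m' = j -> (0 < m' i0)%N -> y m' = 0) ->
  delta *: y m = diff (homotopy l y) m + homotopy l (diff y) m + residue l y m.
Proof.
move=> li0 dm off; rewrite /diff /homotopy /residue; have [ml|ml] := posnP (m l).
  rewrite addr0 (bigD1 l) //= big1 => [|i il]; last first.
    by rewrite mnmDE mnm1E (negPf il) addn0 ml linear0.
  by rewrite mnmDE mnm1E eqxx addn1 addr0 addmK contract_wb_same // subrK.
rewrite addr0 raddf_sum -big_split (bigD1 l) //= big1 => [|i il].
  by rewrite addr0 mnmDE mnm1E eqxx addn1 -addU_subU // addmK contract_wb_same // subrK.
rewrite mnmDE mnm1E (negPf il) addn0 ml -addU_subU //.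
have [->|ii0] := eqVneq i i0; last by rewrite contract_wb // addNr.
rewrite off ?linear0 ?addr0 //.
  by rewrite addU_subU // mdegD mdeg1 addn1 mdeg_subU.
by rewrite addU_subU // mnmDE mnm1E eqxx addn1.
Qed.

Let regroup (V : zmodType) (a b c d e : V) : a - (b + c) - e = a - b - (c + d + e) + d.
Proof. by rewrite (addrAC c) (opprD (c + _)) addrA subrK !opprD !addrA. Qed.

Let regroup' (V : zmodType) (a b c : V) : c = a + b + c - a - b.
Proof. by rewrite (addrC (a + b)) addrA (addrAC _ b) !addrK. Qed.

(** The homotopies are applied for each l in s in turn; z is the part of y left over, supported on
    exponents without the indices in s. *)
Lemma koszul_complex_list j s y : i0 \notin s ->
    (forall m, mdeg m = j -> (0 < m i0)%N -> y m = 0) ->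
    (forall m, (mdeg m).+1 = j -> vanishes P (diff y m)) ->
  exists (u z : D), [/\ forall m, mdeg m = j -> vanishes P (delta ^+ size s *: y m - diff u m - z m),
    forall m, mdeg m = j -> (0 < m i0)%N -> z m = 0,
    forall m, (mdeg m).+1 = j -> vanishes P (diff z m) &
    forall m l, mdeg m = j -> l \in s -> (0 < m l)%N -> z m = 0].
Proof.
move=> i0s off cyc; elim: s i0s => [|l s IH] /=.
  exists (fun=> 0), y; split=> // m _; rewrite scale1r /diff big1 ?subr0 ?subrr.
    exact: vanishes0.
  by move=> i _; rewrite linear0.
rewrite in_cons negb_or => /andP[i0l i0s].
have [u [z [hz zoff zcyc z0]]] := IH i0s.
have li0 : l != i0 by rewrite eq_sym.
exists (fun m => delta *: u m + homotopy l z m), (residue l z); split=> [m dm|m dm mi0|m dm|m l' dm].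
- have -> : delta ^+ (size s).+1 *: y m - diff (fun m => delta *: u m + homotopy l z m) m - residue l z m
    = delta *: (delta ^+ size s *: y m - diff u m - z m) + homotopy l (diff z) m.
    rewrite diffD diffZ !scalerBr scalerA -exprS (homotopyE li0 dm zoff).
    set c := diff (homotopy l z) m; set d := homotopy l (diff z) m.
    exact: regroup.
  apply: vanishesD; first exact/vanishesZ/hz.
  rewrite /homotopy; case: posnP => [_|ml]; first exact: vanishes0.
  by apply/vanishes_wedge/zcyc; rewrite mdeg_subU.
- by rewrite /residue zoff // !linear0 if_same.
- have -> : diff (residue l z) m =
      diff (fun m' => delta *: z m' - diff (homotopy l z) m' - homotopy l (diff z) m') m.
    apply: eq_diff => m'; rewrite dm => dm'; rewrite (homotopyE li0 dm' zoff).
    set a := diff _ m'; set b := homotopy l (diff z) m'.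
    exact: regroup'.
  rewrite diffB diffB diffZ diff_diff subr0; apply: vanishesB; first exact/vanishesZ/zcyc.
  apply: vanishes_diff => m' dm'; rewrite /homotopy; case: posnP => [_|ml]; first exact: vanishes0.
  by apply/vanishes_wedge/zcyc; rewrite mdeg_subU // dm'.
- rewrite inE => /orP[/eqP->|l's] ml; rewrite /residue ?ml //.
  by rewrite (z0 _ l') // !linear0 if_same.
Qed.

Lemma koszul_complex_exact j y : (0 < j)%N ->
    (forall m, mdeg m = j -> (0 < m i0)%N -> y m = 0) ->
    (forall m, (mdeg m).+1 = j -> vanishes P (diff y m)) ->
  exists u : D, forall m, mdeg m = j -> vanishes P (delta ^+ n.-1 *: y m - diff u m).
Proof.
move=> j0 off cyc.
have [|u [z [hz zoff _ z0]]] := @koszul_complex_list j (others i0) y _ off cyc.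
  by rewrite mem_others eqxx.
exists u => m dm; have := hz m dm; rewrite size_others.
(* An exponent of positive degree contains some index, so nothing is left over once all indices are
   treated. *)
suff -> : z m = 0 by rewrite (subr0 (_ - diff u m)).
have [i mi] : exists i, (0 < m i)%N.
  apply/existsP; apply: contraTT j0; rewrite negb_exists -leqNgt -dm mdegE => /forallP no.
  by rewrite leqn0 big1 // => i _; apply/eqP; rewrite -leqn0 leqNgt.
have [ii0|ii0] := eqVneq i i0; first by apply: zoff => //; rewrite -ii0.
by apply: (z0 m i) => //; rewrite mem_others.
Qed.

Lemma diff0 m : diff (fun=> 0) m = 0.
Proof. by rewrite /diff big1 // => i _; rewrite linear0. Qed.

Lemma mula0 m : mula (fun=> 0) m = 0.
Proof. by rewrite /mula big1 // => i _; rewrite scaler0. Qed.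

(* Modulo the tautological element, e_i0 is a combination of the other e_i once
   x_i0 is inverted; as e_i0 e^(m - U_i0) = m_i0 e^(m), this requires dividing by
   m_i0, whence the assumption on the characteristic. *)
Lemma reduce_var j e y : (forall c, (0 < c <= e)%N -> c%:R != 0 :> R) ->
    (forall m, mdeg m = j -> (e < m i0)%N -> y m = 0) ->
  exists g y0 : D, forall m, mdeg m = j ->
    x0 ^+ e *: y m = mula g m + y0 m /\ ((0 < m i0)%N -> y0 m = 0).
Proof.
elim: e y => [|e IH] y char hy.
  by exists (fun=> 0), y => m dm; rewrite scale1r mula0 add0r; split=> //; apply: hy.
(* Chosen so that [mula g0] agrees with x_i0 y at exponents with m_i0 = e + 1; there only the term
   of [mula] at [i0] survives. *)
pose g0 : D := fun m => if m i0 == e then (e.+1%:R^-1)%:MP *: y (m + U_(i0))%MM else 0.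
have [c /andP[c0 ce]||g [y0 Hy0]] := IH (fun m => x0 *: y m - mula g0 m).
- by apply: char; rewrite c0 leqW.
- move=> m dm em; rewrite /mula (bigD1 i0) //= big1 => [|i ii0]; last first.
    have [->|mi] := posnP (m i); first by rewrite mulr0n scale0r.
    by rewrite /g0 mnmBE mnm1E (negPf ii0) subn0 gtn_eqF // scaler0.
  have mi0 : (0 < m i0)%N by apply: leq_ltn_trans em.
  have Um : (U_(i0) <= m)%MM by rewrite lep1mP -lt0n.
  rewrite addr0 /g0 mnmBE mnm1E eqxx subn1 submK //; case: eqP => [e1|ne].
    have -> : m i0 = e.+1 by rewrite -e1 prednK.
    rewrite scalerA mulrC mul_mpolyC -scaler_nat scalerA mulVf ?scale1r ?subrr //.
    by apply: char; rewrite leqnn.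
  rewrite hy ?scaler0 ?subr0 // ltn_neqAle em andbT.
  by apply: contra_notN ne => /eqP <-.
exists (fun m => g m + x0 ^+ e *: g0 m), y0 => m dm; have [E0 off] := Hy0 m dm; split=> //.
by rewrite mulaD mulaZ addrAC -E0 scalerBr scalerA -exprSr subrK.
Qed.

(** At m + U_i0, [mula y] is (m_i0 + 1) x_i0 [y m] plus values of y at exponents with larger
    i0-coordinate, so a descending induction on that coordinate applies. *)
Lemma mula_injective j y : (forall c, (0 < c < j)%N -> c%:R != 0 :> R) -> kill P x0 != 0 ->
    (forall m, (mdeg m).+1 = j -> (0 < m i0)%N -> vanishes P (mula y m)) ->
  forall m, (mdeg m).+2 = j -> vanishes P (y m).
Proof.
move=> char kx hy.
suff step e : forall m : 'X_{1..n}, (mdeg m).+2 = j -> (j <= e + m i0)%N -> vanishes P (y m).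
  by move=> m dm; apply: (step j) => //; apply: leq_addr.
have mi_le (m : 'X_{1..n}) : (m i0 <= mdeg m)%N by rewrite mdegE (bigD1 i0) //= leq_addr.
elim: e => [|e IH] m dm le.
  by move: (leq_trans le (mi_le m)); rewrite -dm; rewrite leqNgt ltnW.
have dmU : (mdeg (m + U_(i0))%MM).+1 = j by rewrite mdegD mdeg1 addn1.
have mU : (m + U_(i0))%MM i0 = (m i0).+1 by rewrite mnmDE mnm1E eqxx addn1.
have := hy _ dmU; rewrite mU /mula (bigD1 i0) //= mU addmK => /(_ isT) van.
apply: (@vanishes_cancel _ _ _ _ (x0 *+ (m i0).+1)).
  rewrite -scaler_nat killZ scaler_eq0 negb_or kx andbT; apply: char.
  by rewrite -dm !ltnS mi_le.
rewrite -[X in vanishes _ X](addrK (\sum_(i < n | i != i0)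
  ('X_i *+ (m + U_(i0))%MM i) *: y (m + U_(i0) - U_(i))%MM)).
apply: vanishesB => //; apply: vanishes_sum => i ii0.
rewrite mnmDE mnm1E eq_sym (negPf ii0) addn0.
have [->|mi] := posnP (m i); first by rewrite mulr0n scale0r; apply: vanishes0.
rewrite addU_subU //; apply/vanishesZ/IH; first by rewrite mdegD mdeg1 addn1 mdeg_subU.
by rewrite mnmDE mnmBE !mnm1E eqxx (negPf ii0) subn0 addn1 addnS.
Qed.

(** Modulo the image of [mula], y is reduced to some y0 without e_i0. Then [diff y0] has no e_i0
    either, so the cycle condition and [mula_injective] make y1 vanish. Hence y0 is a cycle of the
    Koszul-type complex in the other indices, which is exact. *)
Lemma total_exact j y y' : (0 < j)%N -> (forall c, (0 < c <= j)%N -> c%:R != 0 :> R) ->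
    (forall m, (mdeg m).+1 = j -> vanishes P (diff y m + mula y' m)) ->
    (forall m, (mdeg m).+3 = j -> vanishes P (diff y' m)) ->
  let f := x0 ^+ j * delta ^+ n.-1 in
  exists u u' : D,
    (forall m, mdeg m = j -> vanishes P (f *: y m - (diff u m + mula u' m))) /\
    (forall m, (mdeg m).+2 = j -> vanishes P (f *: y' m + diff u' m)).
Proof.
move=> j0 char H1 H2 f; have [kf|kf] := eqVneq (kill P f) 0.
  exists (fun=> 0), (fun=> 0); split=> m _; rewrite diff0.
    by rewrite mula0 addr0 subr0; apply: vanishes_mul.
  by rewrite addr0; apply: vanishes_mul.
have kx : kill P x0 != 0.
  apply: contraNneq kf => kx; rewrite killM -(prednK j0) exprS killM kx.
  by rewrite !mul0r.
have [|m dm lt|g [y0 Hy0]] := @reduce_var j j y; first exact: char.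
  by move: lt; rewrite -dm mdegE (bigD1 i0) //= ltnNge leq_addr.
pose y1 : D := fun m => x0 ^+ j *: y' m + diff g m.
have cyc0 m : (mdeg m).+1 = j -> vanishes P (diff y0 m + mula y1 m).
  move=> dm; have -> : diff y0 m + mula y1 m = x0 ^+ j *: (diff y m + mula y' m).
    rewrite (eq_diff (z := fun m' => x0 ^+ j *: y m' - mula g m')); last first.
      by move=> m'; rewrite dm => /Hy0 [-> _]; rewrite [X in X - _]addrC addrK.
    by rewrite diffB diffZ diff_mula /y1 mulaD mulaZ [X in _ + X]addrC addrA subrK -scalerDr.
  exact/vanishesZ/H1.
have diff_y0 m : (mdeg m).+1 = j -> (0 < m i0)%N -> diff y0 m = 0.
  move=> dm mi0; rewrite /diff big1 // => i _.
  have dU : mdeg (m + U_(i))%MM = j by rewrite mdegD mdeg1 addn1.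
  have [_ ->] := Hy0 _ dU; first exact: linear0.
  by rewrite mnmDE addn_gt0 mi0.
have van_y1 m : (mdeg m).+2 = j -> vanishes P (y1 m).
  apply: mula_injective => // [c /andP[c0 cj]|m' dm' mi0]; first by apply: char; rewrite c0 ltnW.
  by have := cyc0 _ dm'; rewrite diff_y0 // add0r.
have [||u Hu] := @koszul_complex_exact j y0 j0.
- by move=> m /Hy0 [].
- move=> m dm; rewrite -[X in vanishes _ X](addrK (mula y1 m)); apply: vanishesB; first exact: cyc0.
  by apply: vanishes_mula => m' dm'; apply: van_y1; rewrite dm'.
exists u, (fun m => delta ^+ n.-1 *: g m); split=> m dm.
  rewrite mulaZ /f mulrC -scalerA; have [-> _] := Hy0 _ dm.
  rewrite scalerDr; set a := _ *: mula g m; set b := _ *: y0 m.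
  have -> : a + b - (diff u m + a) = b - diff u m by rewrite opprD addrA addrAC (addrAC a) subrr add0r.
  exact: Hu.
rewrite diffZ /f mulrC -scalerA -scalerDr; exact/vanishesZ/van_y1.
Qed.

End LocalExactness.

(** * Global exactness by cutting with the variables *)

Section Cutting.

(** The form in which the Nullstellensatz globalizes local exactness; J will be the annihilator of a
    homology module. *)
Hypothesis spread : forall J : S -> Prop, J 0 ->
  (forall f g, J f -> J g -> J (f + g)) -> (forall h f, J f -> J (h * f)) ->
  (forall i0 beta delta,
    (forall i l, i != i0 -> l != i0 ->
       dotp N (alpha i) (beta l) = if i == l then delta else 0) ->
    exists e e', J ('X_i0 ^+ e * delta ^+ e')) ->
  exists s, forall m, mdeg m = s -> J 'X_[m].
Hypothesis n_ge3 : (2 < n)%N.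
Hypothesis char_big : forall c, (0 < c <= n - 3)%N -> c%:R != 0 :> R.

Let spread_var J i : J 0 ->
  (forall f g, J f -> J g -> J (f + g)) -> (forall h f, J f -> J (h * f)) ->
  (forall i0 beta delta,
    (forall i l, i != i0 -> l != i0 ->
       dotp N (alpha i) (beta l) = if i == l then delta else 0) ->
    exists e e', J ('X_i0 ^+ e * delta ^+ e')) ->
  exists s, J ('X_i ^+ s).
Proof.
move=> J0 JD JM Jl; have [s Hs] := spread J0 JD JM Jl; exists s.
rewrite mpolyXn; apply: Hs; by rewrite mdegMn mdeg1 mul1n.
Qed.

(* C_(j+3) consists of the pairs (y, y') with y in divided power degree j and y'
   in degree j - 2; its differential is (y, y') |-> (diff y + mula y', - diff y'),
   followed by [splice] for j = 0.  Everything is taken modulo the variables in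
   P, and only the values of y and y' in the relevant degree matter. *)
Definition is_cycle P j y y' :=
  [/\ j = 0 -> vanishes P (splice (y 0%MM)),
      forall m, (mdeg m).+1 = j -> vanishes P (diff y m + mula y' m) &
      forall m, (mdeg m).+3 = j -> vanishes P (diff y' m)].

Definition is_boundary P j y y' (u u' : D) :=
  (forall m, mdeg m = j -> vanishes P (y m - (diff u m + mula u' m))) /\
  (forall m, (mdeg m).+2 = j -> vanishes P (y' m + diff u' m)).

(** Here c is the degree of the coefficients, so exactness is asserted in degrees strictly above
    those of the generators of C_(j+3). *)
Definition exact_at P j := forall c y y', (0 < c)%N ->
  (forall m, homog_part c (y m) = y m) -> (forall m, homog_part c (y' m) = y' m) ->
  is_cycle P j y y' -> exists u u' : D, is_boundary P j y y' u u'.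

Lemma vanishes_predU P Q u : vanishes P u -> vanishes (predU P Q) u.
Proof.
rewrite /vanishes => hu.
rewrite (eq_coef_map (h := kill (predU Q P))); last first.
  by move=> s; apply: eq_kill => i; rewrite /= orbC.
rewrite -(coef_map_comp (g := kill Q) (h := kill P)) ?hu ?raddf0 // => s.
exact: kill_kill.
Qed.

Lemma vanishes_var P i u : P i -> vanishes P ('X_i *: u).
Proof. by move=> Pi; apply: vanishes_mul; rewrite kill_var Pi. Qed.

Lemma vanishes_cancel_var P i u : ~~ P i -> vanishes P ('X_i *: u) -> vanishes P u.
Proof. by move=> nPi; apply: vanishes_cancel; rewrite kill_var (negPf nPi) var_neq0. Qed.

Lemma homog_partX d i u : homog_part d.+1 ('X_i *: u) = 'X_i *: homog_part d u.
Proof. by rewrite -add1n; apply: homog_partZ; rewrite dhomogX; apply/eqP/mdeg1. Qed.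

Lemma homog_partD d u v : homog_part d (u + v) = homog_part d u + homog_part d v.
Proof. exact: raddfD. Qed.

Lemma homog_partB d u v : homog_part d (u - v) = homog_part d u - homog_part d v.
Proof. exact: raddfB. Qed.

(* If 'X_i y is a boundary du, then u is a cycle modulo 'X_i, hence
   u = dv + 'X_i w and y = dw. *)
Lemma cut_step P j i c y y' (u u' : D) : ~~ P i -> exact_at (predU P (pred1 i)) j.+1 -> (0 < c)%N ->
    (forall m, homog_part c (y m) = y m) -> (forall m, homog_part c (y' m) = y' m) ->
    is_boundary P j (fun m => 'X_i *: y m) (fun m => 'X_i *: y' m) u u' ->
  exists w w' : D, is_boundary P j y y' w w'.
Proof.
move=> nPi exact_next c0 hy hy' [b1 b2].
pose u1 : D := fun m => homog_part c (u m); pose u1' : D := fun m => homog_part c (u' m).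
have {}b1 m : mdeg m = j -> vanishes P ('X_i *: y m - (diff u1 m + mula u1' m)).
  move=> dm; have := vanishes_homog_part c.+1 (b1 m dm).
  by rewrite homog_partB homog_partD homog_partX hy -homog_part_diff -homog_part_mula.
have {}b2 m : (mdeg m).+2 = j -> vanishes P ('X_i *: y' m + diff u1' m).
  move=> dm; have := vanishes_homog_part c.+1 (b2 m dm).
  by rewrite homog_partD homog_partX hy' -homog_part_diff.
have Pi : predU P (pred1 i) i by rewrite /= eqxx orbT.
have [|||v [v' [e1 e2]]] := exact_next c u1 u1' c0.
- by move=> m; apply: homog_partK.
- by move=> m; apply: homog_partK.
- split=> // m [dm].
    have -> : diff u1 m + mula u1' m = 'X_i *: y m - ('X_i *: y m - (diff u1 m + mula u1' m)).
      by rewrite opprB [RHS]addrC subrK.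
    by apply: vanishesB; [apply: vanishes_var | apply/vanishes_predU/b1].
  have -> : diff u1' m = ('X_i *: y' m + diff u1' m) - 'X_i *: y' m by rewrite [RHS]addrC addKr.
  by apply: vanishesB; [apply/vanishes_predU/b2 | apply: vanishes_var].
pose r m := u1 m - (diff v m + mula v' m); pose r' m := u1' m + diff v' m.
pose w m := coef_map (var_quot i) (r m); pose w' m := coef_map (var_quot i) (r' m).
have hr m : mdeg m = j.+1 -> vanishes P (r m - 'X_i *: w m).
  by move=> dm; apply/vanishes_predU1/e1.
have hr' m : (mdeg m).+2 = j.+1 -> vanishes P (r' m - 'X_i *: w' m).
  by move=> dm; apply/vanishes_predU1/e2.
exists w, w'; split=> m dm; apply: (vanishes_cancel_var nPi).
  have -> : 'X_i *: (y m - (diff w m + mula w' m)) =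
     ('X_i *: y m - (diff u1 m + mula u1' m)) +
     (diff (fun m => r m - 'X_i *: w m) m + mula (fun m => r' m - 'X_i *: w' m) m).
    rewrite diffB mulaB !diffZ !mulaZ scalerBr scalerDr.
    rewrite (diffB u1) (diffD (diff v)) diff_diff add0r diff_mula (mulaD u1').
    set a := diff u1 m; set b := mula u1' m; set d := mula (diff v') m.
    set A := _ *: y m; set B := _ *: diff w m; set C := _ *: mula w' m.
    have -> : a - d - B + (b + d - C) = a + b - (B + C).
      by rewrite (addrAC a) (addrAC b) addrACA addrA subrK addrACA opprD addrA.
    by rewrite addrA subrK.
  apply: vanishesD; first exact: b1.
  apply: vanishesD; first by apply: vanishes_diff => m'; rewrite dm => dm'; apply: hr.
  by apply: vanishes_mula => m' dm'; apply: hr'; rewrite dm' dm.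
have -> : 'X_i *: (y' m + diff w' m) =
   ('X_i *: y' m + diff u1' m) - diff (fun m => r' m - 'X_i *: w' m) m.
  rewrite diffB diffZ (diffD u1') diff_diff addr0 scalerDr opprB.
  by rewrite -addrA [diff u1' m + _]addrC subrK.
apply: vanishesB; first exact: b2.
by apply: vanishes_diff => m' dm'; apply: hr'; rewrite dm' -dm.
Qed.

Lemma boundary_cancel P j i s c y y' (u u' : D) : ~~ P i -> exact_at (predU P (pred1 i)) j.+1 ->
    (0 < c)%N ->
    (forall m, homog_part c (y m) = y m) -> (forall m, homog_part c (y' m) = y' m) ->
    is_boundary P j (fun m => 'X_i ^+ s *: y m) (fun m => 'X_i ^+ s *: y' m) u u' ->
  exists w w' : D, is_boundary P j y y' w w'.
Proof.
move=> nPi ex c0 hy hy'.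
have hX t z : (forall m, homog_part c (z m) = z m) ->
    forall m, homog_part (t + c) ('X_i ^+ t *: z m) = 'X_i ^+ t *: z m.
  move=> hz m; rewrite -[in RHS]hz; apply: homog_partZ.
  by rewrite mpolyXn dhomogX; apply/eqP; rewrite /= mdegMn mdeg1 mul1n.
elim: s u u' => [|s IH] u u' [b1 b2].
  by exists u, u'; split=> m dm; [have := b1 m dm | have := b2 m dm]; rewrite expr0 scale1r.
have [||||w [w' bw]] := @cut_step P j i (s + c) (fun m => 'X_i ^+ s *: y m)
   (fun m => 'X_i ^+ s *: y' m) u u' nPi ex.
- by rewrite addn_gt0 c0 orbT.
- exact: hX.
- exact: hX.
- by split=> m dm; [have := b1 m dm | have := b2 m dm]; rewrite exprS -scalerA.
exact: IH bw.
Qed.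

(** The homology at C_(j+3) is killed by a power of x_i, by local exactness and the Nullstellensatz;
    [boundary_cancel] then removes the factors x_i one at a time. *)
Lemma exact_pred P j i : ~~ P i -> (j <= n - 3)%N ->
  exact_at (predU P (pred1 i)) j.+1 -> exact_at P j.
Proof.
move=> nPi jn ex.
pose J f := forall y y', is_cycle P j y y' ->
  exists u u' : D, is_boundary P j (fun m => f *: y m) (fun m => f *: y' m) u u'.
have [||||s Js] := @spread_var J i.
- move=> y y' _; exists (fun=> 0), (fun=> 0); split=> m _; rewrite diff0 scale0r.
    by rewrite mula0 addr0 subr0; apply: vanishes0.
  by rewrite addr0; apply: vanishes0.
- move=> f g Jf Jg y y' cyc; have [u [u' [b1 b2]]] := Jf _ _ cyc.
  have [v [v' [d1 d2]]] := Jg _ _ cyc.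
  exists (fun m => u m + v m), (fun m => u' m + v' m); split=> m dm.
    rewrite diffD mulaD scalerDl [diff u m + _ + _]addrACA opprD addrACA.
    by apply: vanishesD; [apply: b1 | apply: d1].
  rewrite diffD scalerDl addrACA.
  by apply: vanishesD; [apply: b2 | apply: d2].
- move=> h f Jf y y' cyc; have [u [u' [b1 b2]]] := Jf _ _ cyc.
  exists (fun m => h *: u m), (fun m => h *: u' m); split=> m dm.
    by rewrite diffZ mulaZ -scalerDr -scalerA -scalerBr; apply/vanishesZ/b1.
  by rewrite diffZ -scalerA -scalerDr; apply/vanishesZ/b2.
- move=> i0 beta delta dual; case: (posnP j) => [j0|j0]; last first.
    exists j, n.-1 => y y' [_ h1 h2]; apply: (total_exact dual) => // d /andP[d0 dj].
    by apply: char_big; rewrite d0 (leq_trans dj).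
  exists 0, n.-1 => y y' [/(_ j0)/(splice_kernel dual) [v hv] _ _]; rewrite expr0 mul1r.
  (* The family v is placed on the exponents of degree 1, that is, on the e_l. *)
  pose u : D := fun m => if [pick l | m == U_(l)%MM] is Some l then v l else 0.
  have uU l : u U_(l)%MM = v l.
    rewrite /u; case: pickP => [l' /eqP/mnmP/(_ l)|/(_ l)]; last by rewrite eqxx.
    by rewrite !mnm1E eqxx; case: eqP => [->|].
  exists u, (fun=> 0); split=> m; last by rewrite j0.
  rewrite j0 => /eqP; rewrite mdeg_eq0 => /eqP ->; rewrite mula0 addr0 /diff.
  by under eq_bigr do rewrite add0m uU.
move=> c y y' c0 hy hy' cyc; have [u [u' bu]] := Js _ _ cyc.
exact: boundary_cancel nPi ex c0 hy hy' bu.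
Qed.

Let below t : pred 'I_n := fun i => (i < t)%N.

Lemma eq_exact_at P Q j : P =1 Q -> exact_at P j -> exact_at Q j.
Proof.
move=> e ex c y y' c0 hy hy' [h0 h1 h2].
have e' : Q =1 P by move=> i; rewrite e.
have [|u [u' [b1 b2]]] := ex c y y' c0 hy hy'.
  split=> [/h0|m /h1|m /h2]; exact: eq_vanishes.
by exists u, u'; split=> [m /b1|m /b2]; apply: eq_vanishes.
Qed.

(* Once all variables are cut, exactness at C_(n+1) holds for degree reasons. *)
Lemma exact_below d j : (j.+2 + d)%N = n -> exact_at (below j.+2) j.
Proof.
elim: d j => [|d IH] j.
  rewrite addn0 => jn c y y' c0 hy hy' _; exists (fun=> 0), (fun=> 0).
  have van u : homog_part c u = u -> vanishes (below j.+2) u.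
    move=> hu; apply: (@eq_vanishes _ _ _ predT); last exact: homog_part_vanishes hu.
    by move=> i; rewrite /below jn ltn_ord.
  split=> m _; rewrite diff0; first by rewrite mula0 addr0 subr0; apply: van.
  by rewrite addr0; apply: van.
move=> jn; have lt : (j.+2 < n)%N by rewrite -jn addnS ltnS leq_addr.
apply: (@exact_pred _ _ (Ordinal lt)); first by rewrite /below ltnn.
  by rewrite -jn addnS !addSn !subSS subn0 leq_addr.
apply: (@eq_exact_at (below j.+3)); last by apply: IH; rewrite addSnnS.
by move=> i; rewrite /below /= ltnS leq_eqVlt orbC.
Qed.

Let v0 : 'I_n := Ordinal (ltn_trans (isT : 0 < 2)%N n_ge3).
Let v1 : 'I_n := Ordinal (ltn_trans (isT : 1 < 2)%N n_ge3).

Lemma below_succ t (i : 'I_n) : val i = t -> below t.+1 =1 predU (below t) (pred1 i).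
Proof. by move=> <- l; rewrite /below /= ltnS leq_eqVlt orbC. Qed.

Lemma vanishes_below_succ t i u : val i = t -> vanishes (below t.+1) u ->
  vanishes (below t) (u - 'X_i *: coef_map (var_quot i) u).
Proof. by move=> it hu; apply/vanishes_predU1/eq_vanishes/hu/below_succ. Qed.

Lemma vanishes_none u : vanishes (below 0) u -> u = 0.
Proof.
rewrite /vanishes (eq_coef_map (h := id)) => [|s].
  by rewrite coef_map_id.
rewrite -[RHS]comp_mpoly_id; congr (_ \mPo _).
Qed.

(** The cut at C_2. If x_1 u = [splice] y modulo x_0, then y is a cycle modulo x_0 and x_1, so y is
    a boundary plus x_1 q modulo x_0, and u = [splice] q. As [splice] raises degrees by n - 2, y has
    degree c > 0. *)
Lemma splice_exact_step c u : (0 < c)%N -> homog_part (c + (n - 3)) u = u ->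
  (exists y : E, vanishes (below 1) ('X_v1 *: u - splice y)) ->
  exists y : E, vanishes (below 1) (u - splice y).
Proof.
move=> c0 hu [y hy].
have nP1 : ~~ below 1 v1 by [].
pose y1 := homog_part c y.
have hy1 : vanishes (below 1) ('X_v1 *: u - splice y1).
  have := vanishes_homog_part (n - 2 + c) hy; rewrite homog_partB homog_part_splice.
  by rewrite -(subnSK n_ge3) addSn homog_partX addnC hu.
have e2 := @below_succ 1 v1 erefl.
have [|m|m||w [w' [b1 _]]] := @exact_below (n - 2) 0 _ c (fun=> y1) (fun=> 0) c0.
- by rewrite add2n -addn2 subnK // ltnW.
- exact: homog_partK.
- exact: raddf0.
- split=> // _; have -> : splice y1 = 'X_v1 *: u - ('X_v1 *: u - splice y1) by rewrite opprB addrC subrK.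
  apply: (@eq_vanishes _ _ _ (predU (below 1) (pred1 v1))); first by move=> i; rewrite -e2.
  by apply: vanishesB; [apply: vanishes_var | apply: vanishes_predU].
pose q := coef_map (var_quot v1) (y1 - (diff w 0%MM + mula w' 0%MM)).
have := vanishes_below_succ (i := v1) erefl (b1 0%MM mdeg0).
rewrite -/q => /(vanishes_splice (ex_intro _ v1 nP1)).
have mu0 : mula w' 0%MM = 0.
  by rewrite /mula big1 // => i _; rewrite mnm0E mulr0n scale0r.
rewrite mu0 addr0 !spliceB spliceZ {1}/diff splice_sum big1 => [|i _]; last exact: splice_contract.
rewrite subr0 => hq; exists q; apply: (vanishes_cancel_var nP1).
by rewrite scalerBr -(subrK (splice y1) ('X_v1 *: u)) -addrA; apply: vanishesD.
Qed.

Lemma splice_exact c u : (0 < c)%N -> homog_part (c + (n - 3)) u = u ->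
  (forall i, vanishes (below 1) (ia i u)) -> exists y : E, vanishes (below 1) (u - splice y).
Proof.
move=> c0 hu hi.
pose J f := forall u, (forall i, vanishes (below 1) (ia i u)) ->
  exists y : E, vanishes (below 1) (f *: u - splice y).
have [||||s Js] := @spread_var J v1.
- by move=> u' _; exists 0; rewrite scale0r splice0 subr0; apply: vanishes0.
- move=> f g Jf Jg u' hu'; have [y hy] := Jf _ hu'; have [y' hy'] := Jg _ hu'.
  exists (y + y'); rewrite scalerDl spliceD opprD addrACA; exact: vanishesD.
- move=> h f Jf u' hu'; have [y hy] := Jf _ hu'; exists (h *: y).
  by rewrite spliceZ -scalerA -scalerBr; apply: vanishesZ.
- move=> i0 beta delta dual; exists 0, n.-1 => u' hu'; rewrite expr0 mul1r.
  exact: (contract_kernel dual).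
have {Js hi} := Js u hi; move: c u c0 hu; elim: s => [|s IH] c u c0 hu [y hy].
  by exists y; rewrite expr0 scale1r in hy.
apply: (splice_exact_step c0 hu); apply: (IH c.+1) => //.
  by rewrite addSn homog_partX hu.
by exists y; rewrite scalerA -exprSr.
Qed.

(** The cut at C_1. If x_0 z is the image of u, then u is a cycle modulo x_0, so u = x_0 q +
    [splice] y by [splice_exact]; the second term maps to zero. *)
Lemma koszul_exact_step c (z : 'I_n -> S) : (0 < c)%N ->
    (forall i, z i \is (c + (n - 3)).-homog) ->
    (exists u : E, forall i, vacuum N ('X_v0 * z i) = ia i u) ->
  exists u : E, forall i, vacuum N (z i) = ia i u.
Proof.
move=> c0 hz [u hu]; pose u1 := homog_part (c + (n - 3)) u.
have hX : ('X_v0 : S) \is 1.-homog by rewrite dhomogX; apply/eqP/mdeg1.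
have hu1 i : vacuum N ('X_v0 * z i) = ia i u1.
  rewrite /u1 -(homog_part_contract _ _ (alpha_homog i)) -hu /homog_part coef_map_vacuum.
  by rewrite /= pihomog_dE // dhomogM.
have [|i|y hy] := @splice_exact c u1 c0; first exact: homog_partK.
  by rewrite -hu1 -vacuumZ; apply: vanishes_var.
have := vanishes_none (vanishes_below_succ (i := v0) erefl hy).
set q := coef_map _ _ => /eqP; rewrite subr_eq0 subr_eq => /eqP e1.
exists q => i; apply: (@ext_cancel 'X_v0); first exact: var_neq0.
by rewrite vacuumZ hu1 e1 contractD contract_splice addr0 contractZ.
Qed.

Lemma koszul_exact c (z : 'I_n -> S) : (0 < c)%N ->
    (forall i, z i \is (c + (n - 3)).-homog) -> \sum_i 'X_i * z i = 0 ->
  exists kappa : 'I_N -> S, forall i, z i = \sum_(j < N) alpha i j * kappa j.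
Proof.
move=> c0 hz sz.
suff [u hu] : exists u : E, forall i, vacuum N (z i) = ia i u.
  by exists (fun j => coef1 u j) => i; rewrite -coef0_contract -hu coef0_vacuum.
pose J f := forall z : 'I_n -> S, \sum_i 'X_i * z i = 0 ->
  exists u : E, forall i, vacuum N (f * z i) = ia i u.
have [||||s Js] := @spread_var J v0.
- by move=> z' _; exists 0 => i; rewrite mul0r vacuum0 linear0.
- move=> f g Jf Jg z' hz'; have [u hu] := Jf _ hz'; have [u' hu'] := Jg _ hz'.
  by exists (u + u') => i; rewrite mulrDl vacuumD hu hu' contractD.
- move=> h f Jf z' hz'; have [u hu] := Jf _ hz'; exists (h *: u) => i.
  by rewrite -mulrA -vacuumZ hu contractZ.
- move=> i0 beta delta dual; exists 0, 1 => z' hz'.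
  have [u hu] := koszul_kernel dual hz'; exists u => i.
  by rewrite expr0 mul1r expr1 -vacuumZ hu.
have {Js sz} := Js z sz; move: c z c0 hz; elim: s => [|s IH] c z c0 hz [u hu].
  by exists u => i; rewrite -hu expr0 mul1r.
apply: (koszul_exact_step c0 hz); apply: (IH c.+1) => // [i|].
  by rewrite addSn -add1n; apply: dhomogM; rewrite // dhomogX; apply/eqP/mdeg1.
by exists u => i; rewrite mulrA -exprSr.
Qed.

End Cutting.
End BuchsbaumRim.

(** * Dual families at the points of the dual space *)

Section Points.
Variables (k : closedFieldType) (n N : nat) (alpha : 'I_n -> nat -> {mpoly k[n]}).
Local Notation S := {mpoly k[n]}.
Hypothesis alpha_homog : forall i j, alpha i j \is 1.-homog.
(** Trivial resonance in matrix form: for a <> 0, the left kernel of [alpha] at a consists of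
    multiples of a. *)
Hypothesis alpha_rank : forall a b : 'I_n -> k,
  (forall j, (j < N)%N -> \sum_i b i * (alpha i j).@[a] = 0) ->
  forall i l, a i * b l = a l * b i.

Lemma prod_homog (F : 'I_n -> S) : (forall i, F i \is 1.-homog) ->
  \prod_i F i \is n.-homog.
Proof.
move=> hF; rewrite -big_enum -[X in _ \is X.-homog](size_enum_ord n) /=.
elim: (enum 'I_n) => [|i s IH]; first by rewrite big_nil dhomog1.
by rewrite big_cons /= -add1n; apply: dhomogM.
Qed.

(** Constants giving a dual family at the point a are corrected by an adjugate matrix, so that
    duality up to the factor [delta] holds over S. *)
Lemma dual_family (a : 'I_n -> k) i0 : a i0 != 0 ->
  exists (beta : 'I_n -> nat -> S) (delta : S),
    [/\ forall i l, i != i0 -> l != i0 ->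
          dotp N (alpha i) (beta l) = if i == l then delta else 0,
        delta \is n.-homog & delta.@[a] != 0].
Proof.
move=> ai0.
pose A := \matrix_(i < n, j < N) (alpha i j).@[a].
pose e : 'cV[k]_n := \col_i (i == i0)%:R.
(* The extra column forces the coordinate at i0 of a left kernel vector to be zero, which excludes
   the multiples of a. *)
have /row_freeP[X AX] : row_free (row_mx A e).
  apply: inj_row_free => v; rewrite mul_mx_row -[0]row_mx0 => /eq_row_mx[vA ve].
  have vi0 : v 0 i0 = 0.
    have := congr1 (fun M : 'M_1 => M 0 0) ve; rewrite !mxE (bigD1 i0) //= big1 => [|i ii0].
      by rewrite mxE eqxx mulr1 addr0.
    by rewrite mxE (negPf ii0) mulr0.
  apply/rowP => l; rewrite mxE.
  have := alpha_rank (a := a) (b := v 0); move=> /(_ _ i0 l); rewrite vi0 mulr0 => H.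
  have /eqP : a i0 * v 0 l = 0.
    apply: H => j jN; have := congr1 (fun M : 'rV_N => M 0 (Ordinal jN)) vA.
    by rewrite !mxE => E; rewrite -[RHS]E; apply: eq_bigr => i _; rewrite mxE.
  by rewrite mulf_eq0 (negPf ai0) => /eqP.
pose kap (m : 'I_n) (j : nat) : k :=
  if m == i0 then 0 else oapp (fun j' => usubmx X j' m) 0 (insub j : option 'I_N).
have kapE i l : i != i0 -> \sum_(j < N) (alpha i j).@[a] * kap l j = ((l != i0) && (i == l))%:R.
  move=> ii0; have [->|li0] := eqVneq l i0.
    by rewrite big1 // => j _; rewrite /kap eqxx mulr0.
  have := congr1 (fun M : 'M_n => M i l) AX.
  rewrite -[X in row_mx _ _ *m X]vsubmxK mul_row_col mxE.
  rewrite [X in _ + X]mxE big1 ?addr0 => [|j _]; last by rewrite mxE (negPf ii0) mul0r.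
  rewrite !mxE => <-; apply: eq_bigr => j _; rewrite mxE /kap (negPf li0).
  by case: insubP => [j' _ /val_inj->|] //; rewrite ltn_ord.
(* At a this matrix is diagonal with entries a_i0 and 1, so its determinant is nonzero there; the
   entry ['X_i0] makes all rows linear and the determinant homogeneous. *)
pose B : 'M[S]_n := \matrix_(i, l) if i == i0 then (if l == i0 then 'X_i0 else 0)
  else \sum_(j < N) alpha i j * (kap l j)%:MP.
exists (fun l j => \sum_m (kap m j)%:MP * (\adj B) m l), (\det B); split.
- move=> i l ii0 li0.
  have -> : (if i == l then \det B else 0) = (B *m \adj B) i l.
    by rewrite mul_mx_adj mxE; case: eqP.
  rewrite /dotp mxE; under eq_bigr do rewrite mulr_sumr.
  rewrite exchange_big; apply: eq_bigr => m _ /=.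
  by rewrite [B i m]mxE (negPf ii0) mulr_suml; apply: eq_bigr => j _; rewrite mulrA.
- apply: rpred_sum => s _; rewrite rpredMsign.
  apply: prod_homog => i; rewrite mxE.
  case: ifP => _; last first.
    by apply: rpred_sum => j _; rewrite mulrC mul_mpolyC; apply/rpredZ/alpha_homog.
  by case: ifP => _; rewrite ?dhomog0 // dhomogX; apply/eqP/mdeg1.
rewrite -[_.@[a]]/(meval a (\det B)) -det_map_mx.
have -> : map_mx (meval a) B = diag_mx (\row_i if i == i0 then a i0 else 1).
  apply/matrixP => i l; rewrite !mxE; have [->|ii0] := eqVneq i i0.
    by rewrite eq_sym; case: eqP => _ /=; rewrite ?mevalXU ?raddf0 ?mulr1n ?mulr0n.
  rewrite raddf_sum /= (eq_bigr (fun j : 'I_N => (alpha i j).@[a] * kap l j)) => [|j _].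
    by rewrite kapE //; have [<-|il] := eqVneq i l; rewrite ?ii0 ?andbF.
  by rewrite mevalM mevalC.
rewrite det_diag; apply/prodf_neq0 => i _; by rewrite mxE; case: ifP => // _; apply: oner_neq0.
Qed.

Lemma nullstellensatz_dual (J : S -> Prop) : J 0 ->
  (forall f g, J f -> J g -> J (f + g)) -> (forall h f, J f -> J (h * f)) ->
  (forall i0 beta delta,
    (forall i l, i != i0 -> l != i0 ->
       dotp N (alpha i) (beta l) = if i == l then delta else 0) ->
    exists e e', J ('X_i0 ^+ e * delta ^+ e')) ->
  exists s, forall m, mdeg m = s -> J 'X_[m].
Proof.
move=> J0 JD JM Jl; apply: homog_nullstellensatz => // a [i0 ai0].
have [beta [delta [dual hd da]]] := dual_family ai0.
have [e [e' Je]] := Jl _ _ _ dual.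
exists (1 * e + n * e')%N, ('X_i0 ^+ e * delta ^+ e'); split=> //.
  by apply: dhomogM; apply: dhomogMn => //; rewrite dhomogX; apply/eqP/mdeg1.
by rewrite mevalM !rmorphXn /= mevalXU mulf_neq0 ?expf_neq0.
Qed.

End Points.

(** * Koszul modules *)

Section Bridge.
Variables (k : closedFieldType) (V : vectType k) (K : {vspace ext2 V}).
Local Notation n := (\dim {:V}).
Local Notation S := {mpoly k[n]}.
Local Notation pairs := {p : 'I_n * 'I_n | (p.1 < p.2)%N}.
Implicit Types (w : ext2 V) (a b : 'Hom(V, k^o)).

(* The component of delta_2(w (x) 1) along the i-th basis vector. *)
Definition koszul_form (w : ext2 V) (i : 'I_n) : S :=
  \sum_(p : pairs) w p *: (((val p).1 == i)%:R *: 'X_((val p).2) - ((val p).2 == i)%:R *: 'X_((val p).1)).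

Lemma koszul_form_homog w i : koszul_form w i \is 1.-homog.
Proof.
have hX (l : 'I_n) : ('X_l : S) \is 1.-homog by rewrite dhomogX; apply/eqP/mdeg1.
by apply: rpred_sum => p _; apply: rpredZ; apply: rpredB; apply: rpredZ.
Qed.

Lemma pick_sum (x : 'I_n -> S) (l : 'I_n) (y : S) :
  \sum_i x i * ((l == i)%:R *: y) = x l * y.
Proof.
rewrite (bigD1 l) //= eqxx scale1r big1 ?addr0 // => i il.
by rewrite eq_sym (negPf il) scale0r mulr0.
Qed.

Lemma koszul_form_koszul w : \sum_i 'X_i * koszul_form w i = 0.
Proof.
rewrite /koszul_form; under eq_bigr do rewrite mulr_sumr.
rewrite exchange_big big1 // => p _ /=.
under eq_bigr do rewrite -scalerAr mulrBr.
by rewrite -scaler_sumr sumrB !pick_sum mulrC subrr scaler0.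
Qed.

Lemma koszul_form_eval w (x y : 'I_n -> k) :
  \sum_i y i * (koszul_form w i).@[x] =
  \sum_(p : pairs) w p * (y (val p).1 * x (val p).2 - y (val p).2 * x (val p).1).
Proof.
under eq_bigr do rewrite /koszul_form raddf_sum mulr_sumr.
rewrite exchange_big; apply: eq_bigr => p _ /=.
under eq_bigr do rewrite mevalZ mevalB !mevalZ !mevalXU mulrCA mulrBr.
rewrite -mulr_sumr sumrB; congr (_ * (_ - _)).
  rewrite (bigD1 (val p).1) //= eqxx mul1r big1 ?addr0 // => i ip.
  by rewrite eq_sym (negPf ip) mul0r mulr0.
rewrite (bigD1 (val p).2) //= eqxx mul1r big1 ?addr0 // => i ip.
by rewrite eq_sym (negPf ip) mul0r mulr0.
Qed.

Lemma ext2_dual_coord a b w : ext2_dual (wedge a b) w =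
  \sum_(p : pairs) w p * (a (bas (val p).1) * b (bas (val p).2) - a (bas (val p).2) * b (bas (val p).1)).
Proof.
rewrite [w in LHS]ext2_gen linear_sum; apply: eq_bigr => p _.
by rewrite linearZ /= ext2_dualE.
Qed.

Lemma wedge_eq0_coord a b : wedge a b = 0 ->
  forall i l, a (bas i) * b (bas l) = a (bas l) * b (bas i).
Proof.
move=> ab0 i l; apply/eqP; rewrite -subr_eq0 -ext2_dualE ab0.
rewrite /ext2_dual /ext2_lift big1 ?zero_lfunE // => p _.
by rewrite ffunE scale0r.
Qed.

Lemma lfun_coord a v : a v = \sum_i crd i v * a (bas i).
Proof.
rewrite -[in LHS](sum_crd v) linear_sum; apply: eq_bigr => i _.
by rewrite linearZ.
Qed.

(** If all minors vanish and a <> 0, then b is the multiple of a determined by one nonzero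
    coordinate. *)
Lemma coord_wedge_eq0 a b :
  (forall i l, a (bas i) * b (bas l) = a (bas l) * b (bas i)) -> wedge a b = 0.
Proof.
move=> ab; have [lw1 lw2] := wedge_bilin 'Hom(V, k^o).
have [/existsP[i ai]|] := boolP [exists i, a (bas i) != 0]; last first.
  rewrite negb_exists => /forallP a0.
  have -> : a = 0.
    apply/lfunP => v; rewrite lfun_coord zero_lfunE big1 // => i _.
    by have := a0 i; rewrite negbK => /eqP ->; rewrite mulr0.
  by apply/ffunP => p; rewrite !ffunE /crd !linear0 !mul0r subr0.
have -> : b = (b (bas i) / a (bas i)) *: a.
  apply/lfunP => v; rewrite scale_lfunE !(lfun_coord _ v) scaler_sumr.
  apply: eq_bigr => l _; rewrite [RHS]mulrCA; congr (_ * _).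
  by apply: (mulfI ai); rewrite ab mulrA mulrCA divff // mulr1 mulrC.
have := lw2 a (b (bas i) / a (bas i)) a 0; rewrite addr0 => ->.
have -> : wedge a 0 = 0 :> ext2 'Hom(V, k^o).
  by apply/ffunP => p; rewrite !ffunE /crd !linear0 !mulr0 subr0.
by rewrite wedge_alt scaler0 addr0.
Qed.

Lemma delta2_tens q w (f : sym V q) : delta2 V q (tens w f) =
  \sum_(p : pairs) w p *: (tens (bas (val p).1) (vmul (bas (val p).2) f) -
                           tens (bas (val p).2) (vmul (bas (val p).1) f)).
Proof.
have [lt1 _] := tens_bilin (ext2 V) (sym V q).
pose tM := GRing.isLinear.Build k _ _ _ _ (lt1 f).
pose t : {linear ext2 V -> tensor (ext2 V) (sym V q)} := HB.pack (fun w => tens w f) tM.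
rewrite -[tens w f]/(t w) [w in LHS]ext2_gen !linear_sum; apply: eq_bigr => p _.
by rewrite !linearZ /= delta2E.
Qed.

Lemma sym1_bas i : sym1 (bas i : V) = 'X_i.
Proof.
rewrite /sym1 (bigD1 i) //= crd_bas eqxx scale1r big1 ?addr0 // => l li.
by rewrite crd_bas (negPf li) scale0r.
Qed.

Lemma delta2_tens_coord q w (f : sym V q) i :
  (delta2 V q (tens w f) i : S) = koszul_form w i * f.
Proof.
rewrite delta2_tens sum_ffunE raddf_sum mulr_suml; apply: eq_bigr => p _ /=.
rewrite !ffunE !crd_bas ![i == _]eq_sym linearZ /= -scalerAl; congr (_ *: _).
by rewrite mulrBl -!scalerAl !sym1_bas.
Qed.

Lemma delta1_coord q (z : tensor V (sym V q)) :
  (delta1 V q z : S) = \sum_i 'X_i * (z i : S).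
Proof.
rewrite /delta1 (tens_linfunE (@vmul_bilin k V q)) /tens_lift raddf_sum.
by apply: eq_bigr => i _ /=; rewrite sym1_bas.
Qed.


Lemma functional_of_coord (x : 'I_n -> k) : exists a, forall i, a (bas i) = x i.
Proof.
pose f (v : V) : k^o := \sum_i crd i v * x i.
have lf : linear f.
  move=> c u v; rewrite /f scaler_sumr -big_split; apply: eq_bigr => i _ /=.
  by rewrite crdP mulrDl -mulrA.
exists (linfun f) => i; rewrite linfunE // /f (bigD1 i) //= crd_bas eqxx mul1r.
by rewrite big1 ?addr0 // => l li; rewrite crd_bas (negPf li) mul0r.
Qed.

Local Notation N := (\dim K).
Let gen (j : nat) : ext2 V := (vbasis K)`_j.
Let alpha (i : 'I_n) (j : nat) : S := koszul_form (gen j) i.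

Let gen_mem j : gen j \in K.
Proof.
have [lt|le] := ltnP j (size (vbasis K)); first by apply/vbasis_mem/mem_nth.
by rewrite /gen nth_default // mem0v.
Qed.

(** A left kernel vector y at x gives functionals a, b with a /\ b zero on K; if a /\ b were
    nonzero, a would be a nonzero resonant point. *)
Let alpha_rank : (forall a, resonance K a <-> a = 0) ->
  forall x y : 'I_n -> k, (forall j, (j < N)%N -> \sum_i y i * (alpha i j).@[x] = 0) ->
  forall i l, x i * y l = x l * y i.
Proof.
move=> res x y xy0 i l.
have [a ax] := functional_of_coord x; have [b bx] := functional_of_coord y.
rewrite -!ax -!bx; move: i l; apply: wedge_eq0_coord.
apply: boolp.contrapT => ab0.
have a0 : a = 0.
  apply/res; left; exists b; split=> //; apply/perpP => w wK.
  rewrite (coord_vbasis wK) linear_sum big1 // => j _.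
  rewrite linearZ /= ext2_dual_coord.
  have := xy0 j (ltn_ord j); rewrite koszul_form_eval => e.
  apply/eqP; rewrite mulf_eq0; apply/orP; right; rewrite -oppr_eq0 -[X in _ == X]e -sumrN.
  apply/eqP/eq_bigr => p _; rewrite !ax !bx -mulrN opprB; congr (_ * _).
  by rewrite mulrC [X in _ - X]mulrC.
by apply: ab0; rewrite a0; apply: coord_wedge_eq0 => i l; rewrite !zero_lfunE !mul0r.
Qed.

Lemma koszul_module_vanishes q : (3 <= n)%N ->
    (forall c, (0 < c <= n - 3)%N -> c%:R != 0 :> k) ->
    (forall a, resonance K a <-> a = 0) -> (n - 3 <= q)%N ->
  forall x : koszul_module K q, x = 0.
Proof.
move=> n3 char res nq; apply/quotv_eq0/subvP => z; rewrite memv_ker => /eqP dz.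
have sz : \sum_i 'X_i * (z i : S) = 0 by rewrite -delta1_coord dz.
pose o : 'I_n := Ordinal (ltn_trans (isT : 0 < 2)%N n3).
pose l0 : 'I_n := Ordinal (ltn_trans (isT : 1 < 2)%N n3).
have l0o : l0 != o by rewrite -val_eqE.
have alpha_homog i j : alpha i j \is 1.-homog by apply: koszul_form_homog.
(* The coordinates of z have degree q + 1 = c + (n - 3), and c > 0 because q >= n - 3. *)
have [|i|kappa Hk] := koszul_exact alpha_homog (fun j => koszul_form_koszul (gen j)) l0o
   (nullstellensatz_dual alpha_homog (alpha_rank res)) n3 char (c := q.+1 - (n - 3))
   (z := fun i => z i : S) _ _ sz.
- by rewrite subn_gt0 ltnS.
- by rewrite subnK ?dhomog_is_dhomog // leqW.
have zE i : (z i : S) = \sum_(j < N) alpha i j * kappa j by exact: Hk.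
(* The coefficients [kappa] need not be homogeneous; as [alpha] is linear, only their degree q parts
   contribute to z. *)
pose f j : sym V q := DHomog (pihomogP mdeg q (kappa j)).
have -> : z = delta2 V q (\sum_(j < N) tens (gen j) (f j)).
  apply/ffunP => i; apply: val_inj => /=; rewrite linear_sum sum_ffunE raddf_sum /=.
  under eq_bigr do rewrite delta2_tens_coord.
  transitivity (pihomog mdeg q.+1 (\sum_(j < N) alpha i j * kappa j)).
    by rewrite -zE pihomog_dE // dhomog_is_dhomog.
  rewrite raddf_sum; apply: eq_bigr => j _.
  by rewrite /= -add1n (pihomogMl _ _ (alpha_homog i j)).
by apply/memv_img/memv_suml => j _; apply: ktens_mem.
Qed.

(* Pairing z with b in the tensor factor and evaluating at a in the symmetric
   factor kills delta_2 (K (x) Sym V) as soon as a /\ b vanishes on K. *)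
Let pairing (a b : 'Hom(V, k^o)) q (z : tensor V (sym V q)) : k :=
  \sum_i b (bas i) * (z i : S).@[fun l => a (bas l)].

Let pairing_linear a b q c (z z' : tensor V (sym V q)) :
  pairing a b (c *: z + z') = c * pairing a b z + pairing a b z'.
Proof.
rewrite /pairing mulr_sumr -big_split; apply: eq_bigr => i _ /=.
have -> : ((c *: z + z') i : S) = c *: (z i : S) + (z' i : S) by rewrite !ffunE.
by rewrite mevalD mevalZ mulrDr mulrCA.
Qed.

Let pairing_delta2 a b q w (f : sym V q) :
  pairing a b (delta2 V q (tens w f)) = - (ext2_dual (wedge a b) w * (f : S).@[fun l => a (bas l)]).
Proof.
rewrite /pairing; under eq_bigr do rewrite delta2_tens_coord mevalM mulrA.
rewrite -mulr_suml koszul_form_eval ext2_dual_coord -mulNr -sumrN; congr (_ * _).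
by apply: eq_bigr => p _; rewrite -[RHS]mulrN opprB; congr (_ * (_ - _)); rewrite mulrC.
Qed.

Lemma resonance_trivial q : (forall x : koszul_module K q, x = 0) ->
  forall a, resonance K a -> a = 0.
Proof.
move/quotv_eq0/subvP => sub a [[b [ab ab0]]|//]; apply: boolp.contrapT => a0.
have [i0 ai0] : exists i, a (bas i) != 0.
  apply: boolp.contrapT => no; apply: a0; apply/lfunP => v.
  rewrite lfun_coord zero_lfunE big1 // => i _.
  by have [->|ai] := eqVneq (a (bas i)) 0; [rewrite mulr0 | case: no; exists i].
have [i [l ail]] : exists i l, a (bas i) * b (bas l) - a (bas l) * b (bas i) != 0.
  apply: boolp.contrapT => no; apply: ab0; apply: coord_wedge_eq0 => i l.
  apply/eqP; rewrite -subr_eq0; apply: boolp.contrapT => /negP ne; apply: no.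
  by exists i, l.
have hX : ('X_i0 ^+ q : S) \is q.-homog.
  by rewrite -[X in X.-homog]mul1n; apply: dhomogMn; rewrite dhomogX; apply/eqP/mdeg1.
pose f : sym V q := DHomog hX.
(* The boundary of (e_i /\ e_l) (x) x_i0^q is a cycle whose pairing is, up to sign, a nonzero minor
   times a_i0^q; it vanishes if the cycle comes from K. *)
have [] := boolp.pselect (pairing a b (delta2 V q (tens (wedge (bas i) (bas l)) f)) = 0); last first.
  case; have /sub/memv_imgP[_ /memv_imgP[s _ ->] ->] :
      delta2 V q (tens (wedge (bas i) (bas l)) f) \in lker (delta1 V q.+1).
    by rewrite memv_ker delta1_delta2.
  rewrite (tens_linfunE (ktens_bilin K q)) /tens_lift linear_sum.
  have P0 : pairing a b (0 : tensor V (sym V q.+1)) = 0.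
    by rewrite /pairing big1 // => m _; rewrite ffunE meval0 mulr0.
  elim/big_rec: _ => [//|m z _ IH]; rewrite -[X in X + z]scale1r pairing_linear IH addr0.
  rewrite pairing_delta2 mul1r; have /perpP -> := ab; last exact: subvsP.
  by rewrite mul0r oppr0.
move/eqP; rewrite pairing_delta2 ext2_dualE oppr_eq0 mulf_eq0 (negPf ail) /=.
by rewrite rmorphXn /= mevalXU expf_eq0 (negPf ai0) andbF.
Qed.

End Bridge.

(** * The equivalence of trivial resonance and vanishing *)

Theorem theorem1p3 (k : closedFieldType) (V : vectType k) (n : nat)
    (dimV : \dim {:V} = n) (n_ge3 : (3 <= n)%N) (K : {vspace ext2 V})
    (char_k : [pchar k] =i pred0 \/
              exists p : nat, p \in [pchar k] /\ (n - 2 <= p)%N) :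
  (forall a : 'Hom(V, k^o), resonance K a <-> a = 0) <->
  (forall q : nat, (n - 3 <= q)%N -> forall x : koszul_module K q, x = 0).
Proof.
subst n; split=> [res q|van a].
  apply: koszul_module_vanishes => // c /andP[c0 cn].
  (* In characteristic p >= n - 2, the integers 0 < c <= n - 3 are smaller than p, hence
     invertible. *)
  case: char_k => [/pcharf0P ->|[p [pk np]]]; first by rewrite -lt0n.
  rewrite -(dvdn_pcharf pk) gtnNdvd // (leq_trans _ np) //.
  by rewrite -(subnSK n_ge3) ltnS.
split=> [|->]; last by right.
exact: resonance_trivial (van _ (leqnn _)) a.
Qed.
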